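(* Let $\mathbf M^*\in\mathbb R^{d_1\times\cdots\times d_m}$ be an $m$-th order tensor of Tucker rank $\mathbf r=(r_1,\dots,r_m)$ and signal strength $\underline\lambda:=\min_{j=1,\dots,m}\sigma_{r_j}(\mathbf M^*_{(j)})$, and let $f:\mathbb R^{d_1\times\cdots\times d_m}\to\mathbb R_+$ be of the form $f(\mathbf M)=\sum_{i=1}^n\rho(\langle\mathbf M,\mathbf X_i\rangle-Y_i)$ with $\rho:\mathbb R\to\mathbb R_+$. Let $\tau_{\rm comp}>\tau_{\rm stat}>0$ and $\mu_{\rm comp},\mu_{\rm stat},L_{\rm comp},L_{\rm stat}>0$, and suppose $f$ satisfies the tensor dual-phase regularity conditions (see context) with respect to $\mathbf M^*$ with these parameters. There is a small absolute constant $c_0>0$ such that the following holds. Suppose $\mathbf M_0\in\mathbb M_{\mathbf r}$ satisfies $$\|\mathbf M_0-\mathbf M^*\|_{\rm F}\le c_0\underline\lambda\cdot\min\Big\{\frac{1}{m+1}\frac{\mu_{\rm stat}^2}{L_{\rm stat}^2},\ \frac1{m+1}\frac{\mu_{\rm comp}^2}{L_{\rm comp}^2},\ \frac1{m(m+3)}\frac{\mu_{\rm stat}}{L_{\rm stat}},\ \frac1{m(m+3)}\frac{\mu_{\rm comp}}{L_{\rm comp}}\Big\},$$ and $\eta_0\in\big[0.25(m+1)^{-1}\|\mathbf M_0-\mathbf M^*\|_{\rm F}\,\mu_{\rm comp}L_{\rm comp}^{-2},\ 0.75(m+1)^{-1}\|\mathbf M_0-\mathbf M^*\|_{\rm F}\,\mu_{\rm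 comp}L_{\rm comp}^{-2}\big]$. Let $(\mathbf M_l)$ be generated by tensor RsGrad (see context), with stepsizes chosen at every iteration according to the phase as below. At the $l$-th iteration (all earlier iterates being at distance at least $\tau_{\rm stat}$ from $\mathbf M^*$): (1) When $\|\mathbf M_l-\mathbf M^*\|_{\rm F}\ge\tau_{\rm comp}$ (phase one), take $\eta_l=\big(1-\frac1{16(m+1)}\frac{\mu_{\rm comp}^2}{L_{\rm comp}^2}\big)^l\eta_0$; then $$\|\mathbf M_l-\mathbf M^*\|_{\rm F}\le\Big(1-\frac{1}{16(m+1)}\cdot\frac{\mu_{\rm comp}^2}{L_{\rm comp}^2}\Big)^l\|\mathbf M_0-\mathbf M^*\|_{\rm F}.$$ (2) When $\tau_{\rm comp}>\|\mathbf M_l-\mathbf M^*\|_{\rm F}\ge\tau_{\rm stat}$ (phase two), take $\eta_l\in[0.25(m+1)^{-1}\mu_{\rm stat}L_{\rm stat}^{-2},\ 0.75(m+1)^{-1}\mu_{\rm stat}L_{\rm stat}^{-2}]$; then $$\|\mathbf M_{l+1}-\mathbf M^*\|_{\rm F}\le\Big(1-\frac1{16(m+1)}\cdot\frac{\mu_{\rm stat}^2}{L_{\rm stat}^2}\Big)\|\mathbf M_l-\mathbf M^*\|_{\rm F}.$$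
   Context: Tensor notation. For $\mathbf M\in\mathbb R^{d_1\times\cdots\times d_m}$, $\mathbf M_{(j)}$ is the mode-$j$ matricization ($d_j\times\prod_{l\ne j}d_l$), $\times_j$ is mode-$j$ multiplication by a matrix, so $(\mathbf M\times_j\mathbf U^\top)_{(j)}=\mathbf U^\top\mathbf M_{(j)}$, and $\mathbf C\cdot\llbracket\mathbf U_1,\dots,\mathbf U_m\rrbracket=\mathbf C\times_1\mathbf U_1\times_2\cdots\times_m\mathbf U_m$. The Tucker rank is $({\rm rank}\,\mathbf M_{(1)},\dots,{\rm rank}\,\mathbf M_{(m)})$; $\mathbb M_{\mathbf r}=\{\mathbf M:{\rm rank}(\mathbf M_{(j)})\le r_j\ \forall j\}$. $\langle\cdot,\cdot\rangle$ and $\|\cdot\|_{\rm F}$ are the entrywise inner product and Frobenius norm; $\sigma_k(\cdot)$ is the $k$-th largest singular value. $\|\mathbf G\|_{{\rm F},2\mathbf r}=\sup\|\mathbf G\cdot\llbracket\mathbf U_1^\top,\dots,\mathbf U_m^\top\rrbracket\|_{\rm F}$ over $\mathbf U_j\in\mathbb R^{d_j\times2r_j}$ with orthonormal columns. The data $(\mathbf X_i,Y_i)$ are fixed (deterministic statement). $\partial f(\mathbf M)$ is the set of $\mathbf G$ with $f(\mathbf N)\ge f(\mathbf M)+\langle\mathbf G,\mathbf N-\mathbf M\rangle$ for all $\mathbf N$. Tensor dual-phase regularity conditions. Let $\mathbb B_1=\{\mathbf M\in\mathbb M_{\mathbf r}:\|\mathbf M-\mathbf M^*\|_{\rm F}\ge\tau_{\rm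 comp}\}$, $\mathbb B_2=\{\mathbf M\in\mathbb M_{\mathbf r}:\tau_{\rm comp}>\|\mathbf M-\mathbf M^*\|_{\rm F}\ge\tau_{\rm stat}\}$. (a) $f(\mathbf M)-f(\mathbf M^* )\ge\mu_{\rm comp}\|\mathbf M-\mathbf M^*\|_{\rm F}$ on $\mathbb B_1$ and $\ge\mu_{\rm stat}\|\mathbf M-\mathbf M^*\|_{\rm F}^2$ on $\mathbb B_2$. (b) For every $\mathbf G\in\partial f(\mathbf M)$: $\|\mathbf G\|_{{\rm F},2\mathbf r}\le L_{\rm comp}$ if $\mathbf M\in\mathbb B_1$, and $\|\mathbf G\|_{{\rm F},2\mathbf r}\le L_{\rm stat}\|\mathbf M-\mathbf M^*\|_{\rm F}$ if $\mathbf M\in\mathbb B_2$. Tensor RsGrad: from $\mathbf M_0\in\mathbb M_{\mathbf r}$, for $l=0,1,\dots$ choose any $\mathbf G_l\in\partial f(\mathbf M_l)$ and set $\mathbf M_{l+1}={\rm HOSVD}_{\mathbf r}(\mathbf M_l-\eta_l\mathcal P_{\mathbb T_l}(\mathbf G_l))$. Here ${\rm HOSVD}_{\mathbf r}(\mathbf M)=\mathbf M\cdot\llbracket\mathbf U_1\mathbf U_1^\top,\dots,\mathbf U_m\mathbf U_m^\top\rrbracket$ with $\mathbf U_j$ the top-$r_j$ left singular vectors of $\mathbf M_{(j)}$; and for the Tucker decomposition $\mathbf M_l=\mathbf C\cdot\llbracket\mathbf U_1,\dots,\mathbf U_m\rrbracket$ (core $\mathbf C\in\mathbb R^{r_1\times\cdots\times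 r_m}$, $\mathbf U_j$ with orthonormal columns), $\mathcal P_{\mathbb T_l}$ is the projection onto the tangent space of $\mathbb M_{\mathbf r}$ at $\mathbf M_l$: $\mathcal P_{\mathbb T_l}(\mathbf G)=\mathbf G\cdot\llbracket\mathbf U_1\mathbf U_1^\top,\dots,\mathbf U_m\mathbf U_m^\top\rrbracket+\sum_{i=1}^m\mathbf C\times_{j\ne i}\mathbf U_j\times_i\dot{\mathbf U}_i$, $\dot{\mathbf U}_i=(\mathbf I-\mathbf U_i\mathbf U_i^\top)\mathbf G_{(i)}(\otimes_{j\ne i}\mathbf U_j)\mathbf C_{(i)}^\dagger$. *)

(* Defs.v *)
From HB Require Import structures.
From mathcomp Require Import all_boot all_order all_algebra.
From mathcomp Require Import boolp classical_sets reals.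
Set Implicit Arguments.
Unset Strict Implicit.
Unset Printing Implicit Defensive.
Import Order.TTheory GRing.Theory Num.Theory.
Local Open Scope ring_scope.
Local Open Scope classical_set_scope.

Section Matrices.
Context {R : realType}.

Definition orthonormal_cols (d k : nat) (U : 'M[R]_(d, k)) : Prop :=
  U^T *m U = 1%:M.

(* Full singular value decomposition A = U S V^T with S rectangular diagonal.
   The singular values are s 0 >= s 1 >= ..., padded with zeros after the
   first minn d p. *)
Definition is_svd (d p : nat) (A : 'M[R]_(d, p))
    (U : 'M[R]_d) (s : nat -> R) (V : 'M[R]_p) : Prop :=
  [/\ orthonormal_cols U, orthonormal_cols V,
      (forall i, 0 <= s i) /\ (forall i j, (i <= j)%N -> s j <= s i),
      (forall i, (minn d p <= i)%N -> s i = 0) &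
      A = U *m (\matrix_(i < d, k < p) (s i *+ (i == k :> nat))) *m V^T].

(* The k-th largest singular value, counted from k = 1. *)
Definition singval (d p : nat) (k : nat) (A : 'M[R]_(d, p)) : R :=
  xget 0 [set x | exists U s V, is_svd A U s V /\ x = s k.-1].

(* Right multiplication by pid_mx k extracts the first k columns (k <= d). *)
Definition top_left_singvec (d p k : nat) (A : 'M[R]_(d, p))
    (Uk : 'M[R]_(d, k)) : Prop :=
  exists U s V, is_svd A U s V /\ Uk = U *m (pid_mx k : 'M_(d, k)).

(* The Moore-Penrose inverse, given by the four Penrose equations;
   mathcomp's pinvmx is only a partial inverse. *)
Definition mp_inv (d p : nat) (A : 'M[R]_(d, p)) : 'M[R]_(p, d) :=
  xget 0 [set B | [/\ A *m B *m A = A, B *m A *m B = B,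
                      (A *m B)^T = A *m B & (B *m A)^T = B *m A]].

End Matrices.

Definition tidx (m : nat) (d : 'I_m -> nat) : finType :=
  {dffun forall j : 'I_m, 'I_(d j)}.

Notation tensor R d := {ffun tidx d -> R}.

(* Column indices of the mode-j matricization: multi-indices over the modes
   other than j, so that #|cidx d j| is the product of the d l, l != j. *)
Definition cidx (m : nat) (d : 'I_m -> nat) (j : 'I_m) : finType :=
  {dffun forall l : {l : 'I_m | l != j}, 'I_(d (val l))}.

(* The multi-index equal to a in mode j and to k in the other modes. *)
Definition mode_join (m : nat) (d : 'I_m -> nat) (j : 'I_m)
    (a : 'I_(d j)) (k : cidx d j) : tidx d :=
  finfun (fun l : 'I_m =>
    match eqVneq l j with
    | EqNotNeq e => ecast x 'I_(d x) (esym e) a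
    | NeqNotEq ne => k (exist _ l ne)
    end).

Lemma mode_join_eq (m : nat) (d : 'I_m -> nat) (j : 'I_m)
    (a : 'I_(d j)) (k : cidx d j) : mode_join a k j = a.
Proof.
rewrite ffunE; case: eqVneq => [e|ne]; first by rewrite (eq_irrelevance e erefl).
by have := ne; rewrite eqxx.
Qed.

Lemma mode_join_neq (m : nat) (d : 'I_m -> nat) (j : 'I_m)
    (a : 'I_(d j)) (k : cidx d j) (l : {l : 'I_m | l != j}) :
  mode_join a k (val l) = k l.
Proof.
rewrite ffunE; case: l => l nelj /=; case: eqVneq => [e|ne].
  by case/eqP: (nelj).
by rewrite (bool_irrelevance ne nelj).
Qed.

Section Tensors.
Context {R : realType} {m : nat}.
Implicit Types d p r : 'I_m -> nat.

Definition matricize d (j : 'I_m) (M : tensor R d) :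
    'M[R]_(d j, #|cidx d j|) :=
  \matrix_(a, b) M (mode_join a (enum_val b)).

(* M . [[ V_1, ..., V_m ]], i.e. M x_1 V_1 x_2 ... x_m V_m. *)
Definition tucker d p (M : tensor R d) (V : forall j, 'M[R]_(p j, d j)) :
    tensor R p :=
  [ffun i : tidx p => \sum_(k : tidx d) M k * \prod_j V j (i j) (k j)].

(* The Kronecker product of the U l, l != i, with rows and columns ordered as
   the columns of the mode-i matricizations. *)
Definition kron_others d r (i : 'I_m) (U : forall j, 'M[R]_(d j, r j)) :
    'M[R]_(#|cidx d i|, #|cidx r i|) :=
  \matrix_(a, b) \prod_(l : {l : 'I_m | l != i})
    U (val l) ((enum_val a : cidx d i) l) ((enum_val b : cidx r i) l).

Definition tdot d (M N : tensor R d) : R := \sum_i M i * N i.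

Definition tnorm d (M : tensor R d) : R := Num.sqrt (tdot M M).

Definition tucker_rank d (M : tensor R d) (j : 'I_m) : nat :=
  \rank (matricize j M).

Definition low_rank d r (M : tensor R d) : Prop :=
  forall j, (tucker_rank M j <= r j)%N.

Definition signal_strength d r (M : tensor R d) : R :=
  inf (range (fun j : 'I_m => singval (r j) (matricize j M))).

(* || G ||_{F, 2r}. A d_j x 2 r_j matrix with orthonormal columns exists only
   if 2 r_j <= d_j; the number of columns is capped at d_j so that the
   supremum is never taken over the empty set. *)
Definition tnorm2r d r (G : tensor R d) : R :=
  sup [set x | exists U : forall j, 'M[R]_(d j, minn (2 * r j) (d j)),
         (forall j, orthonormal_cols (U j)) /\
         x = tnorm (tucker G (fun j => (U j)^T))].

Definition subdiff d (f : tensor R d -> R) (M : tensor R d) :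
    set (tensor R d) :=
  [set G | forall N, f M + tdot G (N - M) <= f N].

Definition loss d (n : nat) (rho : R -> R) (X : 'I_n -> tensor R d)
    (Y : 'I_n -> R) (M : tensor R d) : R :=
  \sum_(i < n) rho (tdot M (X i) - Y i).

Definition phase1 d r (Mstar : tensor R d) (tau_comp : R) :
    set (tensor R d) :=
  [set M | low_rank r M /\ tau_comp <= tnorm (M - Mstar)].

Definition phase2 d r (Mstar : tensor R d) (tau_comp tau_stat : R) :
    set (tensor R d) :=
  [set M | low_rank r M /\ tau_stat <= tnorm (M - Mstar) < tau_comp].

Definition dual_phase_regular d r (f : tensor R d -> R) (Mstar : tensor R d)
    (tau_comp tau_stat mu_comp mu_stat L_comp L_stat : R) : Prop :=
  [/\ forall M, phase1 r Mstar tau_comp M ->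
        mu_comp * tnorm (M - Mstar) <= f M - f Mstar,
      forall M, phase2 r Mstar tau_comp tau_stat M ->
        mu_stat * tnorm (M - Mstar) ^+ 2 <= f M - f Mstar,
      forall M G, phase1 r Mstar tau_comp M -> subdiff f M G ->
        tnorm2r r G <= L_comp &
      forall M G, phase2 r Mstar tau_comp tau_stat M -> subdiff f M G ->
        tnorm2r r G <= L_stat * tnorm (M - Mstar)].

(* A relation, since the singular vectors need not be unique. *)
Definition is_hosvd d r (M N : tensor R d) : Prop :=
  exists U : forall j, 'M[R]_(d j, r j),
    (forall j, top_left_singvec (matricize j M) (U j)) /\
    N = tucker M (fun j => U j *m (U j)^T).

Definition dotU d r (C : tensor R r) (U : forall j, 'M[R]_(d j, r j))
    (G : tensor R d) (i : 'I_m) : 'M[R]_(d i, r i) :=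
  (1%:M - U i *m (U i)^T) *m matricize i G *m kron_others i U
    *m mp_inv (matricize i C).

(* The projection onto the tangent space at tucker C U; dfwith U D is U with
   its i-th component replaced by D. *)
Definition tangent_proj d r (C : tensor R r) (U : forall j, 'M[R]_(d j, r j))
    (G : tensor R d) : tensor R d :=
  tucker G (fun j => U j *m (U j)^T)
  + \sum_(i < m) tucker C (dfwith U (dotU C U G i)).

(* M' is a possible next iterate from M, with stepsize eta. *)
Definition rsgrad_step d r (f : tensor R d -> R) (eta : R)
    (M M' : tensor R d) : Prop :=
  exists (G : tensor R d) (C : tensor R r) (U : forall j, 'M[R]_(d j, r j)),
    [/\ subdiff f M G,
        forall j, orthonormal_cols (U j),
        M = tucker C U &
        is_hosvd r [ffun i => M i - eta * tangent_proj C U G i] M'].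

End Tensors.

Definition rate {R : realType} (m : nat) (mu L : R) : R :=
  1 - 1 / (16 * (m.+1)%:R) * (mu ^+ 2 / L ^+ 2).

(* Stepsize rule at iteration l, where D is the distance of the current
   iterate to the target. *)
Definition stepsize_rule {R : realType} (m : nat)
    (tau_comp tau_stat mu_comp mu_stat L_comp L_stat eta0 : R)
    (l : nat) (D eta : R) : Prop :=
  (tau_comp <= D -> eta = rate m mu_comp L_comp ^+ l * eta0) /\
  (tau_stat <= D < tau_comp ->
     1 / 4 * (m.+1)%:R^-1 * (mu_stat / L_stat ^+ 2) <= eta
       <= 3 / 4 * (m.+1)%:R^-1 * (mu_stat / L_stat ^+ 2)).

(* Main.v *)
Require Import Defs.
From HB Require Import structures.
From mathcomp Require Import all_boot all_order all_algebra.
From mathcomp Require Import boolp classical_sets reals.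
From mathcomp Require Import ring lra.
Set Implicit Arguments.
Unset Strict Implicit.
Unset Printing Implicit Defensive.
Import Order.TTheory GRing.Theory Num.Theory.
Local Open Scope ring_scope.

(** Write [X] for an iterate, [E = X - Mstar], [D] for the norm of [E], [PT] for
    the tangent projection at [X], [lam] for the signal strength and [G] for the
    subgradient.  One step moves [X] to [N = X - eta PT G] and truncates [N].

    The distance of [N] to the target obeys
    [|N - Mstar|^2 = D^2 - 2 eta <PT G, E> + eta^2 |PT G|^2].  As [PT] is an
    orthogonal projection, [<PT G, E> = <G, E> - <G, E - PT E>].  The first term
    is at least [f X - f Mstar], hence at least [mu D] by sharpness.  In the
    second one, [E - PT E = - (Mstar - PT Mstar)] has Tucker rank at most [2 r]
    and norm at most [2 m D^2 / lam] ([tangent_residual]), so it pairs with [G]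
    for at most [L] times that norm, [L] being the bound on the dual norm of [G]
    ([tdot_tnorm2r]).  Also [PT G] has Tucker rank at most [2 r], whence
    [|PT G|^2 = <G, PT G> <= L |PT G|] and [|PT G| <= L].

    The truncation is compared with [X], not with [Mstar].  The point [N] is
    [X] plus a tangent vector of size at most [eta L], and HOSVD displaces such a point
    by at most [m (eta L)^2 / (lam - D)] ([hosvd_tangent_step]).  This is of
    second order in the step length, and so proportional to [mu^2 / L^2], which
    a perturbation bound around [Mstar] would not give.  It rests on
    [eckart_young] and on the stability of the smallest nonzero singular value
    ([right_inverse_perturb]); [lam] enters only through generalised inverses of
    the matricizations of [Mstar] of norm at most [1 / lam] ([ginv_singval]).

    These estimates combine ([step_arith]) into a contraction that covers both
    phases ([rsgrad_step_contract]): phase two is the case where sharpness and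
    subgradient bound are [mu_stat D] and [L_stat D].  In phase one the step
    size follows the upper bound [Db] of the distance rather than the distance
    [D] itself; the squared distance after the tangent step is a convex function
    of [D], largest on [0, Db] at [D = Db].  An induction then shows that an
    iterate that has entered phase two never returns to phase one. *)

(** * Real inner products *)

(** Cauchy-Schwarz, the triangle inequality and homogeneity for a positive
    semidefinite symmetric form; [scale] is an explicit parameter so that the
    statements apply to matrices and to tensors of scalars alike. *)
Section InnerProduct.
Context {R : realType} {V : zmodType}.
Variables (scale : R -> V -> V) (dot : V -> V -> R).
Hypothesis dotC : forall u v, dot u v = dot v u.
Hypothesis dotDl : forall u v w, dot (u + v) w = dot u w + dot v w.
Hypothesis dotZl : forall a u v, dot (scale a u) v = a * dot u v.
Hypothesis dot_ge0 : forall u, 0 <= dot u u.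

Lemma ip_cauchy_schwarz u v :
  dot u v <= Num.sqrt (dot u u) * Num.sqrt (dot v v).
Proof.
have dotDr x y z : dot x (y + z) = dot x y + dot x z.
  by rewrite dotC dotDl !(dotC x).
have dotZr a x y : dot x (scale a y) = a * dot x y by rewrite dotC dotZl dotC.
have pos t : 0 <= dot u u + 2 * t * dot u v + t ^+ 2 * dot v v.
  have := dot_ge0 (u + scale t v).
  rewrite dotDl !dotDr !dotZl !dotZr (dotC v u); lra.
set A := dot u u in pos *; set C := dot u v in pos *.
set B := dot v v in pos *.
have A0 : 0 <= A by exact: dot_ge0.
have B0 : 0 <= B by exact: dot_ge0.
have CAB : C ^+ 2 <= A * B.
  have [B1|B1] := eqVneq B 0.
    have [->|C0] := eqVneq C 0; first by rewrite expr0n /= mulr_ge0.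
    have := pos (- (A + 1) / (2 * C)).
    rewrite B1 mulr0 addr0.
    have -> : 2 * (- (A + 1) / (2 * C)) * C = - (A + 1) by field.
    lra.
  have := pos (- C / B).
  have -> : A + 2 * (- C / B) * C + (- C / B) ^+ 2 * B = (A * B - C ^+ 2) / B.
    by field.
  have Bp : 0 < B by rewrite lt_def B1.
  by rewrite pmulr_lge0 ?invr_gt0 // subr_ge0.
rewrite -sqrtrM // (le_trans (ler_norm C)) // -sqrtr_sqr.
by rewrite ler_wsqrtr.
Qed.

Lemma ip_triangle u v :
  Num.sqrt (dot (u + v) (u + v)) <= Num.sqrt (dot u u) + Num.sqrt (dot v v).
Proof.
have := ip_cauchy_schwarz u v.
set a := Num.sqrt (dot u u); set b := Num.sqrt (dot v v) => cs.
have a0 : 0 <= a by exact: sqrtr_ge0.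
have b0 : 0 <= b by exact: sqrtr_ge0.
rewrite -[a + b]ger0_norm ?addr_ge0 // -sqrtr_sqr ler_wsqrtr //.
rewrite dotDl dotC (dotC v) !dotDl (dotC v u).
have -> : dot u u = a ^+ 2 by rewrite sqr_sqrtr.
have -> : dot v v = b ^+ 2 by rewrite sqr_sqrtr.
nra.
Qed.

Lemma ip_scale a u :
  Num.sqrt (dot (scale a u) (scale a u)) = `|a| * Num.sqrt (dot u u).
Proof.
rewrite dotZl dotC dotZl mulrA -expr2 sqrtrM ?sqr_ge0 //.
by rewrite sqrtr_sqr.
Qed.

End InnerProduct.

(** * The Frobenius inner product of matrices *)

Section Frobenius.
Context {R : realType}.

(** The entrywise inner product and the Frobenius norm. *)
Definition mdot d p (A B : 'M[R]_(d, p)) : R := \sum_i \sum_j A i j * B i j.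
Definition mnorm d p (A : 'M[R]_(d, p)) : R := Num.sqrt (mdot A A).

Lemma mdotE d p (A B : 'M[R]_(d, p)) : mdot A B = \tr (A *m B^T).
Proof.
rewrite /mdot /mxtrace; apply: eq_bigr => i _; rewrite mxE.
by apply: eq_bigr => j _; rewrite mxE.
Qed.

Lemma mdotC d p (A B : 'M[R]_(d, p)) : mdot A B = mdot B A.
Proof. by rewrite !mdotE -mxtrace_tr trmx_mul trmxK. Qed.

Lemma mdotDl d p (A B C : 'M[R]_(d, p)) :
  mdot (A + B) C = mdot A C + mdot B C.
Proof. by rewrite !mdotE mulmxDl mxtraceD. Qed.

Lemma mdotZl d p a (A B : 'M[R]_(d, p)) : mdot (a *: A) B = a * mdot A B.
Proof. by rewrite !mdotE -scalemxAl mxtraceZ. Qed.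

Lemma mdotNl d p (A B : 'M[R]_(d, p)) : mdot (- A) B = - mdot A B.
Proof. by rewrite -scaleN1r mdotZl mulN1r. Qed.

Lemma mdotBl d p (A B C : 'M[R]_(d, p)) :
  mdot (A - B) C = mdot A C - mdot B C.
Proof. by rewrite mdotDl mdotNl. Qed.

Lemma mdotBr d p (A B C : 'M[R]_(d, p)) :
  mdot C (A - B) = mdot C A - mdot C B.
Proof. by rewrite mdotC mdotBl !(mdotC C). Qed.

Lemma mdot_ge0 d p (A : 'M[R]_(d, p)) : 0 <= mdot A A.
Proof. by apply: sumr_ge0 => i _; apply: sumr_ge0 => j _; rewrite -expr2 sqr_ge0. Qed.

Lemma mdot_tr d p (A B : 'M[R]_(d, p)) : mdot A^T B^T = mdot A B.
Proof. by rewrite !mdotE trmxK mxtrace_mulC -mdotE mdotC mdotE. Qed.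

Lemma mdot_mull d p q (P : 'M[R]_(d, p)) (A : 'M[R]_(p, q)) (B : 'M[R]_(d, q)) :
  mdot (P *m A) B = mdot A (P^T *m B).
Proof. by rewrite !mdotE trmx_mul trmxK -mulmxA mxtrace_mulC mulmxA. Qed.

Lemma mdot_mulr d p q (Q : 'M[R]_(p, q)) (A : 'M[R]_(d, p)) (B : 'M[R]_(d, q)) :
  mdot (A *m Q) B = mdot A (B *m Q^T).
Proof. by rewrite !mdotE trmx_mul trmxK mulmxA. Qed.

Lemma mnorm_ge0 d p (A : 'M[R]_(d, p)) : 0 <= mnorm A.
Proof. exact: sqrtr_ge0. Qed.
Hint Resolve mnorm_ge0 : core.

Lemma sqr_mnorm d p (A : 'M[R]_(d, p)) : mnorm A ^+ 2 = mdot A A.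
Proof. by rewrite sqr_sqrtr // mdot_ge0. Qed.

Lemma mdot_le d p (A B : 'M[R]_(d, p)) : mdot A B <= mnorm A * mnorm B.
Proof.
exact: (ip_cauchy_schwarz (@mdotC d p) (@mdotDl d p) (@mdotZl d p)
  (@mdot_ge0 d p)).
Qed.

Lemma mnormD d p (A B : 'M[R]_(d, p)) : mnorm (A + B) <= mnorm A + mnorm B.
Proof.
exact: (ip_triangle (@mdotC d p) (@mdotDl d p) (@mdotZl d p) (@mdot_ge0 d p)).
Qed.

Lemma mnormN d p (A : 'M[R]_(d, p)) : mnorm (- A) = mnorm A.
Proof. by rewrite /mnorm mdotNl mdotC mdotNl opprK. Qed.

Lemma mnormB d p (A B : 'M[R]_(d, p)) : mnorm (A - B) <= mnorm A + mnorm B.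
Proof. by rewrite (le_trans (mnormD _ _)) // mnormN. Qed.

Lemma mnorm_tr d p (A : 'M[R]_(d, p)) : mnorm A^T = mnorm A.
Proof. by rewrite /mnorm mdot_tr. Qed.

Lemma mnorm_le_sqr d p d' p' (A : 'M[R]_(d, p)) (B : 'M[R]_(d', p')) :
  mdot A A <= mdot B B -> mnorm A <= mnorm B.
Proof. exact: ler_wsqrtr. Qed.

Lemma mnorm0_eq0 d p (A : 'M[R]_(d, p)) : mnorm A = 0 -> A = 0.
Proof.
move=> A0; have : mdot A A = 0 by rewrite -sqr_mnorm A0 expr0n.
have row0 i : 0 <= \sum_j A i j * A i j.
  by apply: sumr_ge0 => j _; rewrite -expr2 sqr_ge0.
move/eqP; rewrite psumr_eq0 => [/allP h|i _]; last exact: row0.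
apply/matrixP => i j; rewrite mxE.
have := h i (mem_index_enum _) => /=; rewrite psumr_eq0 => [/allP /(_ j)|k _].
  by rewrite mem_index_enum => /(_ isT); rewrite -expr2 sqrf_eq0 => /eqP.
by rewrite -expr2 sqr_ge0.
Qed.

Lemma mnormM d p q (A : 'M[R]_(d, p)) (B : 'M[R]_(p, q)) :
  mnorm (A *m B) <= mnorm A * mnorm B.
Proof.
rewrite -[leRHS]ger0_norm ?mulr_ge0 // -sqrtr_sqr ler_wsqrtr // exprMn !sqr_mnorm.
have -> : mdot B B = \sum_j \sum_k B k j ^+ 2.
  by rewrite exchange_big; apply: eq_bigr => j _; apply: eq_bigr => k _; rewrite expr2.
rewrite big_distrl /=; apply: ler_sum => i _.
rewrite big_distrr /=; apply: ler_sum => j _.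
pose a : 'rV[R]_p := row i A; pose b : 'rV[R]_p := (col j B)^T.
have h : (A *m B) i j = mdot a b.
  by rewrite mxE /mdot big_ord1; apply: eq_bigr => k _; rewrite !mxE.
have -> : \sum_j A i j * A i j = mnorm a ^+ 2.
  by rewrite sqr_mnorm /mdot big_ord1; apply: eq_bigr => k _; rewrite !mxE.
have -> : \sum_k B k j ^+ 2 = mnorm b ^+ 2.
  by rewrite sqr_mnorm /mdot big_ord1; apply: eq_bigr => k _; rewrite !mxE expr2.
have h1 := mdot_le a b.
have h2 : - mdot a b <= mnorm a * mnorm b.
  by rewrite -mdotNl (le_trans (mdot_le _ _)) // mnormN.
rewrite h -exprMn -expr2 -real_normK ?num_real // lerXn2r ?nnegrE ?mulr_ge0 //.
by rewrite ler_norml h1 andbT lerNl.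
Qed.

(** Orthogonal projectors, as symmetric idempotent matrices. *)
Definition orthoproj d (P : 'M[R]_d) : Prop := P^T = P /\ P *m P = P.

Lemma orthoproj1 d : orthoproj (1%:M : 'M[R]_d).
Proof. by split; rewrite ?trmx1 ?mul1mx. Qed.

Lemma orthoprojC d (P : 'M[R]_d) : orthoproj P -> orthoproj (1%:M - P).
Proof.
move=> [sP iP]; split; first by rewrite linearB /= trmx1 sP.
by rewrite mulmxBl mul1mx mulmxBr mulmx1 iP subrr subr0.
Qed.

Lemma orthoproj_cols d k (U : 'M[R]_(d, k)) :
  orthonormal_cols U -> orthoproj (U *m U^T).
Proof.
by move=> oU; split; rewrite ?trmx_mul ?trmxK // mulmxA -(mulmxA U) oU mulmx1.
Qed.

Lemma orthoproj_conj d k (U : 'M[R]_(d, k)) (P : 'M[R]_k) :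
  orthonormal_cols U -> orthoproj P -> orthoproj (U *m P *m U^T).
Proof.
move=> oU [sP iP]; split; first by rewrite !trmx_mul trmxK sP mulmxA.
by rewrite !mulmxA -(mulmxA (U *m P) U^T U) oU mulmx1 -(mulmxA U P P) iP.
Qed.

Lemma mnorm_projl d p (P : 'M[R]_d) (A : 'M[R]_(d, p)) :
  orthoproj P -> mnorm (P *m A) <= mnorm A.
Proof.
move=> [sP iP].
have e : mdot (P *m A) (P *m A) = mdot A (P *m A).
  by rewrite mdot_mull sP mulmxA iP.
have := mdot_le A (P *m A); rewrite -e -sqr_mnorm.
have [->|nz] := eqVneq (mnorm (P *m A)) 0; first by [].
by rewrite expr2 ler_pM2r // lt_def nz mnorm_ge0.
Qed.

Lemma mnorm_projr d p (P : 'M[R]_p) (A : 'M[R]_(d, p)) :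
  orthoproj P -> mnorm (A *m P) <= mnorm A.
Proof. by move=> oP; rewrite -mnorm_tr trmx_mul oP.1 -(mnorm_tr A) mnorm_projl. Qed.

Lemma mnorm_cols d k p (U : 'M[R]_(d, k)) (A : 'M[R]_(k, p)) :
  orthonormal_cols U -> mnorm (U *m A) = mnorm A.
Proof. by move=> oU; rewrite /mnorm mdot_mull mulmxA oU mul1mx. Qed.

Lemma mnorm_colsT d k p (U : 'M[R]_(d, k)) (A : 'M[R]_(p, k)) :
  orthonormal_cols U -> mnorm (A *m U^T) = mnorm A.
Proof. by move=> oU; rewrite -mnorm_tr trmx_mul trmxK mnorm_cols // mnorm_tr. Qed.

Lemma pythagoras d p (P : 'M[R]_d) (A : 'M[R]_(d, p)) :
  orthoproj P ->
  mdot ((1%:M - P) *m A) ((1%:M - P) *m A) = mdot A A - mdot (P *m A) (P *m A).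
Proof.
move=> oP; have [sC iC] := orthoprojC oP; have [sP iP] := oP.
rewrite !mdot_mull sC sP !mulmxA iC iP.
by rewrite mulmxBl mul1mx mdotBr.
Qed.

(** Gram-Schmidt. *)
Lemma orthonormal_rows k d (A : 'M[R]_(k, d)) :
  row_free A -> exists O : 'M[R]_(k, d), O *m O^T = 1%:M /\ (A <= O)%MS.
Proof.
elim: k A => [|k IH] A fA.
  by exists 0; split; [apply/matrixP => -[] | rewrite [A]flatmx0 sub0mx].
move: A fA; rewrite -[k.+1]/(1 + k)%N => A fA.
have fD : row_free (dsubmx A).
  rewrite /row_free eqn_leq rank_leq_row /=.
  rewrite -(leq_add2l 1) -{1}(eqP fA) -{1}(vsubmxK A) -addsmxE.
  by rewrite (leq_trans (mxrank_adds_leqif _ _).1) // leq_add2r rank_leq_row.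
have [O [oO sO]] := IH _ fD.
pose a := usubmx A; pose b := a - a *m O^T *m O.
have bO : b *m O^T = 0 by rewrite mulmxBl -(mulmxA _ O) oO mulmx1 subrr.
have b0 : mnorm b != 0.
  apply/eqP => /mnorm0_eq0 /eqP; rewrite subr_eq0 => /eqP aE.
  have /mxrankS : (A <= O)%MS.
    by rewrite -(vsubmxK A) -addsmxE addsmx_sub sO andbT -/a aE submxMl.
  by rewrite (eqP fA) => h; have := leq_trans h (rank_leq_row O); rewrite ltnn.
pose c := (mnorm b)^-1 *: b.
exists (col_mx c O); split; last first.
  rewrite -(vsubmxK A) -!addsmxE addsmx_sub (submx_trans sO) ?addsmxSr // andbT.
  have -> : usubmx A = mnorm b *: c + a *m O^T *m O.
    by rewrite scalerA divff // scale1r subrK.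
  by apply: addmx_sub_adds; [exact: scalemx_sub | exact: submxMl].
have bb : b *m b^T = (mnorm b ^+ 2)%:M.
  rewrite [LHS]mx11_scalar sqr_mnorm mdotE; congr (_%:M).
  by rewrite /mxtrace big_ord1.
have cc : c *m c^T = 1%:M.
  rewrite linearZ /= -scalemxAl -scalemxAr bb !scale_scalar_mx; congr (_%:M).
  by field.
have cO : c *m O^T = 0 by rewrite -scalemxAl bO scaler0.
have Oc : O *m c^T = 0 by rewrite -[LHS]trmxK trmx_mul trmxK cO trmx0.
by rewrite tr_col_mx mul_col_row oO cc cO Oc -scalar_mx_block.
Qed.

(** Any matrix of rank at most [k] has its column space inside the span of
    [k] orthonormal vectors, as soon as the ambient dimension allows it. *)
Lemma orthonormal_span d p k (A : 'M[R]_(d, p)) :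
  (\rank A <= k)%N -> (k <= d)%N ->
  exists U : 'M[R]_(d, k), orthonormal_cols U /\ U *m U^T *m A = A.
Proof.
move=> rk kd.
pose F : 'M[R]_(k, d) := pid_mx k *m row_ebase A^T.
have fF : row_free F.
  rewrite /row_free mxrankMfree ?row_free_unit ?row_ebase_unit //.
  by rewrite rank_pid_mx.
have sF : (A^T <= F)%MS.
  rewrite -{1}(mulmx_ebase A^T).
  have -> : (pid_mx (\rank A^T) : 'M[R]_(p, d)) =
      (pid_mx (\rank A^T) : 'M_(p, k)) *m (pid_mx k : 'M_(k, d)).
    have h : (\rank A^T <= k)%N by rewrite mxrank_tr.
    by rewrite mul_pid_mx (minn_idPl h) (minn_idPr h).
  by rewrite mulmxA -(mulmxA _ (pid_mx k)) submxMl.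
have [O [oO sO]] := orthonormal_rows fF.
have /submxP[D AE] := submx_trans sF sO.
exists O^T; rewrite /orthonormal_cols trmxK; split => //.
apply: trmx_inj; rewrite !trmx_mul trmxK AE -!mulmxA.
by rewrite (mulmxA O) oO mul1mx.
Qed.

End Frobenius.
#[export] Hint Resolve mnorm_ge0 : core.

(** * Singular values *)

Section SingularValues.
Context {R : realType}.

(** The rectangular diagonal matrix with diagonal [s]. *)
Definition rdiag d p (s : nat -> R) : 'M[R]_(d, p) :=
  \matrix_(i < d, k < p) (s i *+ (i == k :> nat)).

Lemma rdiag_tr d p s : (rdiag d p s)^T = rdiag p d s.
Proof.
by apply/matrixP => i j; rewrite !mxE eq_sym; case: eqP => [->|].
Qed.

Lemma sqr_mnorm_rdiagM d p q s (Z : 'M[R]_(p, q)) :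
  mdot (rdiag d p s *m Z) (rdiag d p s *m Z) =
  \sum_(i < p) (s i ^+ 2 *+ (i < d)%N) * \sum_j Z i j ^+ 2.
Proof.
have gram : (rdiag d p s)^T *m rdiag d p s =
    diag_mx (\row_(k < p) (s k ^+ 2 *+ (k < d)%N)).
  apply/matrixP => k l; rewrite !mxE.
  have [kd|kd] := ltnP k d; last first.
    rewrite mulr0n mul0rn big1 // => i _; rewrite !mxE.
    by rewrite (ltn_eqF (leq_trans (ltn_ord i) kd)) mulr0n mul0r.
  rewrite (bigD1 (Ordinal kd)) //= big1 => [|i]; last first.
    rewrite -val_eqE /= => /negPf ik; rewrite !mxE.
    by rewrite ik mulr0n mul0r.
  by rewrite !mxE /= eqxx mulr1n addr0 -mulrnAr.
rewrite mdot_mull mulmxA gram mdotC; apply: eq_bigr => i _.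
rewrite big_distrr; apply: eq_bigr => j _ /=.
by rewrite mul_diag_mx !mxE expr2 mulrA.
Qed.

(** Among all families of [k] orthonormal vectors, the first [k] basis vectors
    capture the largest part of a nonincreasing weight. *)
Lemma weight_orthonormal_rows d k (W : 'M[R]_(k, d)) (w : nat -> R) :
  W *m W^T = 1%:M -> (k <= d)%N -> (forall i j, (i <= j)%N -> w j <= w i) ->
  \sum_(i < d) w i * (\sum_a W a i ^+ 2) <= \sum_(i < d) w i *+ (i < k)%N.
Proof.
move=> oW kd anti.
have oP : orthoproj (W^T *m W).
  by rewrite -{2}(trmxK W); apply: orthoproj_cols; rewrite /orthonormal_cols trmxK.
have colE i : \sum_a W a i ^+ 2 = (W^T *m W) i i.
  by rewrite mxE; apply: eq_bigr => a _; rewrite mxE expr2.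
have col_le1 i : \sum_a W a i ^+ 2 <= 1.
  have h : mdot (W^T *m W *m delta_mx i (0 : 'I_1)) (W^T *m W *m delta_mx i 0)
      = (W^T *m W) i i.
    rewrite mdot_mull oP.1 mulmxA oP.2 -colE mdotC -mulmxA mdot_mull trmxK.
    apply: eq_bigr => a _; rewrite big_ord1 -expr2.
    congr (_ ^+ 2); rewrite mxE (bigD1 i) //= big1 => [|j /negPf ji].
      by rewrite mxE !eqxx mulr1 addr0.
    by rewrite mxE ji mulr0.
  have n1 : mdot (delta_mx i (0 : 'I_1) : 'M[R]_(d, 1)) (delta_mx i 0) = 1.
    rewrite /mdot (bigD1 i) //= big_ord1 mxE !eqxx mulr1 big1 ?addr0 // => j /negPf ji.
    by rewrite big_ord1 mxE ji mul0r.
  have := pythagoras (delta_mx i (0 : 'I_1)) oP.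
  rewrite h n1 colE => e; have := mdot_ge0 ((1%:M - W^T *m W) *m delta_mx i (0 : 'I_1)).
  by rewrite e subr_ge0.
have tot : \sum_(i < d) \sum_a W a i ^+ 2 = \sum_(i < d) ((i < k)%N)%:R.
  rewrite exchange_big /=.
  transitivity (\sum_(a < k) (1 : R)).
    apply: eq_bigr => a _; transitivity ((W *m W^T) a a).
      by rewrite mxE; apply: eq_bigr => i _; rewrite mxE expr2.
    by rewrite oW mxE eqxx.
  rewrite (big_ord_widen d (fun=> 1) kd) big_mkcond /=.
  by apply: eq_bigr => i _; case: (i < k)%N.
have step (i : 'I_d) : w i * (\sum_a W a i ^+ 2) - w i *+ (i < k)%N
    <= w k * (\sum_a W a i ^+ 2 - ((i < k)%N)%:R).
  have c0 : 0 <= \sum_a W a i ^+ 2 by apply: sumr_ge0 => a _; rewrite sqr_ge0.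
  have [ik|ik] := ltnP i k; rewrite ?mulr1n ?mulr0n.
    by have := anti _ _ (ltnW ik); have := col_le1 i; nra.
  by have := anti _ _ ik; nra.
rewrite -subr_le0 -sumrB (le_trans (ler_sum _ (fun i _ => step i))) //.
by rewrite -mulr_sumr sumrB tot subrr mulr0.
Qed.

(** Eckart-Young: the residual of the projection on the top [k] left singular
    vectors is no larger than the distance to any matrix of rank [<= k]. *)
Lemma eckart_young d p k (A B : 'M[R]_(d, p)) (Uk : 'M[R]_(d, k)) :
  (k <= d)%N -> top_left_singvec A Uk -> (\rank B <= k)%N ->
  orthonormal_cols Uk /\ mnorm (A - Uk *m Uk^T *m A) <= mnorm (A - B).
Proof.
move=> kd [U [s [V [svd UkE]]]] rB.
have [oU oV [s0 anti] _ AE] := svd; rewrite -/(rdiag d p s) in AE.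
have oUk : orthonormal_cols Uk.
  rewrite UkE /orthonormal_cols trmx_mul -mulmxA (mulmxA U^T) oU mul1mx.
  by rewrite tr_pid_mx pid_mx_id // pid_mx_1.
split=> //.
have [O [oO OB]] := orthonormal_span rB kd.
have captured (Q : 'M[R]_(d, k)) : orthonormal_cols Q ->
    mdot (Q *m Q^T *m A) (Q *m Q^T *m A) =
    \sum_(i < d) (s i ^+ 2 *+ (i < p)%N) * \sum_a (Q^T *m U) a i ^+ 2.
  move=> oQ; rewrite -sqr_mnorm -mulmxA mnorm_cols // AE mulmxA mnorm_colsT //.
  rewrite mulmxA -mnorm_tr trmx_mul rdiag_tr sqr_mnorm sqr_mnorm_rdiagM.
  by apply: eq_bigr => i _; congr (_ * _); apply: eq_bigr => a _; rewrite mxE.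
have UUT : U *m U^T = 1%:M by exact: mulmx1C.
have le_cap : mdot (O *m O^T *m A) (O *m O^T *m A) <=
              mdot (Uk *m Uk^T *m A) (Uk *m Uk^T *m A).
  rewrite !captured //.
  have rowsO : (O^T *m U) *m (O^T *m U)^T = 1%:M.
    by rewrite trmx_mul trmxK -mulmxA (mulmxA U) UUT mul1mx.
  pose w i := s i ^+ 2 *+ (i < p)%N.
  have antiw i j : (i <= j)%N -> w j <= w i.
    move=> ij; rewrite /w; have [jp|jp] := ltnP j p.
      by rewrite (leq_ltn_trans ij jp) !mulr1n lerXn2r ?nnegrE ?anti.
    by rewrite mulr0n; case: (i < p)%N; rewrite ?mulr0n // mulr1n sqr_ge0.
  rewrite (le_trans (weight_orthonormal_rows rowsO kd antiw)) //.
  rewrite le_eqVlt; apply/orP; left; apply/eqP; apply: eq_bigr => i _.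
  rewrite -/(w i) UkE trmx_mul tr_pid_mx -mulmxA oU mulmx1.
  have [ik|ik] := ltnP i k.
    rewrite (bigD1 (Ordinal ik)) //= big1 => [|a].
      by rewrite mxE /= eqxx ik expr1n addr0 mulr1.
    by rewrite -val_eqE mxE /= => /negPf ->; rewrite expr0n.
  rewrite big1 ?mulr0 // => a _; rewrite mxE /=.
  by rewrite (ltn_eqF (leq_trans (ltn_ord a) ik)) expr0n.
have oP := orthoproj_cols oUk; have oPO := orthoproj_cols oO.
have -> : A - Uk *m Uk^T *m A = (1%:M - Uk *m Uk^T) *m A by rewrite mulmxBl mul1mx.
apply: (@le_trans _ _ (mnorm ((1%:M - O *m O^T) *m A))).
  by apply: mnorm_le_sqr; rewrite !pythagoras // lerD2l lerN2.
have -> : (1%:M - O *m O^T) *m A = (1%:M - O *m O^T) *m (A - B).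
  have z : (1%:M - O *m O^T) *m B = 0 by rewrite mulmxBl mul1mx OB subrr.
  by rewrite mulmxBr z subr0.
by apply: mnorm_projl; apply: orthoprojC.
Qed.

Lemma singval_ge0 d p k (A : 'M[R]_(d, p)) : 0 <= singval k A.
Proof.
rewrite /singval; case: xgetP => // x _ [U [s [V [[_ _ [s0 _] _ _] ->]]]].
exact: s0.
Qed.

(** If the [r]-th singular value of a matrix of rank [r] is at least [lam > 0],
    the matrix has a generalised inverse of operator norm at most [1 / lam].
    No existence theorem for the singular value decomposition is needed:
    [singval] is [0] by default, which [lam > 0] excludes. *)
Lemma ginv_singval d p (M : 'M[R]_(d, p)) (lam : R) :
  0 < lam -> lam <= singval (\rank M) M ->
  exists B : 'M[R]_(p, d), M *m B *m M = M /\
    forall q (Y : 'M[R]_(d, q)), lam * mnorm (B *m Y) <= mnorm Y.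
Proof.
move=> lam0; rewrite /singval; case: xgetP => [x _|_ h]; last first.
  by have := lt_le_trans lam0 h; rewrite ltxx.
move=> [U [s [V [svd ->]]]] lam_le.
have [oU oV [s0 anti] sz ME] := svd; rewrite -/(rdiag d p s) in ME.
have UUT : U *m U^T = 1%:M by exact: mulmx1C.
have VVT : V *m V^T = 1%:M by exact: mulmx1C.
(* A nonzero [s i] makes the rank at least [i + 1]. *)
have large i : s i != 0 -> lam <= s i.
  move=> si; have imin : (i < minn d p)%N.
    by rewrite ltnNge; apply/negP => /sz e; rewrite e eqxx in si.
  move: (imin); rewrite leq_min => /andP[id ip].
  have si0 j : (j <= i)%N -> s j != 0.
    move=> ji; rewrite gt_eqF // (lt_le_trans _ (anti _ _ ji)) //.
    by rewrite lt_def si s0.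
  suff ir : (i < \rank M)%N.
    by apply: le_trans lam_le (anti _ _ _); rewrite -ltnS prednK // (leq_ltn_trans _ ir).
  have -> : \rank M = \rank (rdiag d p s).
    rewrite ME mxrankMfree ?row_free_unit ?unitmx_tr; last by case: (mulmx1_unit oV).
    by rewrite eqmxMfull // row_full_unit; case: (mulmx1_unit oU).
  rewrite -(rank_pid_mx R id ip).
  have <- : rdiag d p s *m rdiag p p (fun j => (s j)^-1 *+ (j <= i)%N)
      = pid_mx i.+1.
    apply/matrixP => a b; rewrite !mxE.
    have [ap|ap] := ltnP a p; last first.
      rewrite big1 => [|k _]; last first.
        by rewrite mxE (gtn_eqF (leq_trans (ltn_ord k) ap)) mulr0n mul0r.
      by rewrite (gtn_eqF (leq_trans (ltn_ord b) ap)).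
    rewrite (bigD1 (Ordinal ap)) //= big1 => [|k]; last first.
      by rewrite -val_eqE eq_sym mxE /= => /negPf ->; rewrite mul0r.
    rewrite !mxE /= eqxx mulr1n addr0 ltnS.
    have [ai|ai] := leqP a i; last by rewrite mulr0n mul0rn mulr0 andbF.
    by rewrite mulr1n andbT mulrnAr divff // si0.
  exact: mxrankM_maxl.
pose Sp := rdiag p d (fun i => (s i)^-1).
exists (V *m Sp *m U^T); split.
  have SSS : rdiag d p s *m Sp *m rdiag d p s = rdiag d p s.
    have mulSp : rdiag d p s *m Sp = diag_mx (\row_(i < d) ((s i != 0)%:R)).
      apply/matrixP => a b; rewrite !mxE.
      have [ap|ap] := ltnP a p; last first.
        rewrite big1 => [|k _]; last first.
          by rewrite mxE (gtn_eqF (leq_trans (ltn_ord k) ap)) mulr0n mul0r.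
        by rewrite sz ?eqxx ?mul0rn // (leq_trans (geq_minr _ _) ap).
      rewrite (bigD1 (Ordinal ap)) //= big1 => [|k]; last first.
        by rewrite -val_eqE eq_sym mxE /= => /negPf ->; rewrite mul0r.
      rewrite !mxE /= eqxx mulr1n addr0 mulrnAr -val_eqE /=.
      by have [->|e] := eqVneq (s a) 0; rewrite ?mul0r // divff.
    rewrite mulSp; apply/matrixP => a b; rewrite mul_diag_mx !mxE.
    by have [->|e] := eqVneq (s a) 0; rewrite ?mul0r ?mul0rn // mul1r.
  rewrite ME !mulmxA -(mulmxA _ V^T V) oV mulmx1 -(mulmxA _ U^T U) oU mulmx1.
  by rewrite -[in RHS]SSS !mulmxA.
move=> q Y; rewrite -!mulmxA mnorm_cols //.
have <- : mnorm (U^T *m Y) = mnorm Y.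
  by rewrite mnorm_cols // /orthonormal_cols trmxK.
set Z := U^T *m Y.
rewrite -{1}(ger0_norm (ltW lam0)) -sqrtr_sqr -sqrtrM ?sqr_ge0 // ler_wsqrtr //.
rewrite sqr_mnorm_rdiagM mulr_sumr; apply: ler_sum => i _.
have -> : \sum_j Z i j * Z i j = \sum_j Z i j ^+ 2.
  by apply: eq_bigr => j _; rewrite expr2.
rewrite mulrA ler_piMl ?sumr_ge0 // => [j _|]; first by rewrite sqr_ge0.
case: (i < p)%N; last by rewrite mulr0n mulr0.
rewrite mulr1n; have [->|e] := eqVneq (s i) 0; first by rewrite invr0 expr0n mulr0.
have sp : 0 < s i by rewrite lt_def e s0.
rewrite exprVn -expr_div_n expr_le1 // ?divr_ge0 ?(ltW lam0) ?(ltW sp) //.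
by rewrite ler_pdivrMr // mul1r large.
Qed.

(** Stability under perturbation: if [M] of rank [k] has a generalised inverse
    of norm [<= 1 / lam], and [X], at distance [<= eps < lam] from [M], has its
    columns in the span of [k] orthonormal vectors [U], then [X] has a right
    inverse on that span, of norm [<= 1 / (lam - eps)]. *)
Lemma right_inverse_perturb d p k (M X : 'M[R]_(d, p)) (B : 'M[R]_(p, d))
    (U : 'M[R]_(d, k)) (lam eps : R) :
  0 < lam -> eps < lam -> \rank M = k -> M *m B *m M = M ->
  (forall q (Y : 'M[R]_(d, q)), lam * mnorm (B *m Y) <= mnorm Y) ->
  orthonormal_cols U -> U *m U^T *m X = X -> mnorm (X - M) <= eps ->
  exists Y : 'M[R]_(p, d), X *m Y = U *m U^T /\
    forall q (Z : 'M[R]_(d, q)), (lam - eps) * mnorm (Y *m Z) <= mnorm Z.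
Proof.
move=> lam0 el rM MBM Bn oU UX Xeps.
have kd : (k <= d)%N by rewrite -rM rank_leq_row.
have [O [oO OM]] : exists O : 'M[R]_(d, k), orthonormal_cols O /\ O *m O^T *m M = M.
  by apply: orthonormal_span; rewrite ?rM.
(* [B O] is a basis of a complement of the kernel of [M]; [X] stays injective
   on it, hence by equality of dimensions maps it onto the span of [U]. *)
have MBO : M *m B *m O = O.
  have /row_freeP[S OMS] : row_free (O^T *m M).
    rewrite /row_free eqn_leq rank_leq_row /= -{1}rM -{1}OM -mulmxA.
    exact: mxrankM_maxr.
  have OE : O = M *m S by rewrite -[LHS]mulmx1 -OMS !mulmxA OM.
  by rewrite OE mulmxA MBM.
pose W := B *m O; pose T := U^T *m X *m W.
have UT : U *m T = X *m W by rewrite /T !mulmxA UX.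
have Tlow q (A : 'M[R]_(k, q)) : (lam - eps) * mnorm A <= lam * mnorm (T *m A).
  rewrite -(mnorm_cols (T *m A) oU) mulmxA UT.
  have -> : X *m W *m A = O *m A + (X - M) *m (W *m A).
    by rewrite mulmxBl !mulmxA MBO addrC subrK.
  have h1 : mnorm A <= mnorm (O *m A + (X - M) *m (W *m A))
                     + mnorm ((X - M) *m (W *m A)).
    rewrite -(mnorm_cols A oO) -{1}[O *m A](addrK ((X - M) *m (W *m A))).
    exact: mnormB.
  have h2 := mnormM (X - M) (W *m A).
  have h3 : lam * mnorm (W *m A) <= mnorm A.
    by rewrite -mulmxA (le_trans (Bn _ _)) // mnorm_cols.
  have h4 : 0 <= mnorm (W *m A) by [].
  have h5 : 0 <= mnorm (X - M) by [].
  have h6 : mnorm (X - M) * mnorm (W *m A) * lam <= eps * mnorm A.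
    by rewrite -mulrA ler_pM ?mulr_ge0 ?(ltW lam0) // mulrC.
  have h7 := ler_wpM2l (ltW lam0) h1.
  have h8 := ler_wpM2l (ltW lam0) h2.
  lra.
have Tu : T \in unitmx.
  rewrite unitmxE unitfE; apply/negP => /eqP dT.
  have /eqP/det0P[v v0 vT] : \det T^T = 0 by rewrite det_tr.
  have Tv : T *m v^T = 0 by rewrite -[LHS]trmxK trmx_mul trmxK vT trmx0.
  have := Tlow _ v^T; rewrite Tv.
  have -> : mnorm (0 : 'M[R]_(k, 1)) = 0.
    by rewrite /mnorm /mdot big1 ?sqrtr0 // => i _; rewrite big1 // => j _; rewrite mxE mul0r.
  rewrite mulr0 pmulr_rle0 ?subr_gt0 // => v1.
  have /mnorm0_eq0 /(congr1 trmx) : mnorm v^T = 0 by apply/eqP; rewrite eq_le v1 mnorm_ge0.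
  by rewrite trmxK trmx0 => /eqP; apply/negP.
exists (W *m invmx T *m U^T); split.
  by rewrite mulmxA (mulmxA X W) -UT -(mulmxA U T) mulmxV // mulmx1.
move=> q Z.
have h1 : lam * mnorm (W *m invmx T *m U^T *m Z) <= mnorm (invmx T *m (U^T *m Z)).
  by rewrite -!mulmxA (le_trans (Bn _ _)) // mnorm_cols.
have h2 := Tlow _ (invmx T *m (U^T *m Z)).
rewrite [T *m _]mulmxA mulmxV // mul1mx in h2.
have h3 : mnorm (U^T *m Z) <= mnorm Z.
  by rewrite -(mnorm_cols _ oU) mulmxA mnorm_projl //; apply: orthoproj_cols.
have el0 : 0 < lam - eps by rewrite subr_gt0.
rewrite -(ler_pM2l lam0).
apply: (@le_trans _ _ (lam * mnorm (U^T *m Z))); last by rewrite ler_pM2l.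
apply: le_trans h2.
by rewrite mulrCA ler_pM2l.
Qed.

(** The Moore-Penrose inverse exists, so that its defining equations hold. *)
Lemma mp_invP d p (A : 'M[R]_(d, p)) (B := mp_inv A) :
  [/\ A *m B *m A = A, B *m A *m B = B,
      (A *m B)^T = A *m B & (B *m A)^T = B *m A].
Proof.
rewrite /B /mp_inv; apply: (@xgetPex _ 0 [set B | [/\ A *m B *m A = A,
  B *m A *m B = B, (A *m B)^T = A *m B & (B *m A)^T = B *m A]]%classic) => /=.
have [k rA] : exists k, \rank A = k by exists (\rank A).
have kd : (k <= d)%N by rewrite -rA rank_leq_row.
have [U [oU UA]] := orthonormal_span (eq_leq rA) kd.
(* Full rank factorisation [A = U D O] with [D] invertible. *)
have fF : row_free (U^T *m A).
  by rewrite /row_free eqn_leq rank_leq_row /= -{1}rA -{1}UA -mulmxA mxrankM_maxr.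
have [O [oO /submxP[D DO]]] := orthonormal_rows fF.
have Du : D \in unitmx.
  rewrite -row_full_unit /row_full eqn_leq rank_leq_col /= -{1}(eqP fF) DO.
  exact: mxrankM_maxl.
have AE : A = U *m D *m O by rewrite -{1}UA -!mulmxA DO.
exists (O^T *m invmx D *m U^T); rewrite {}AE.
have AB : U *m D *m O *m (O^T *m invmx D *m U^T) = U *m U^T.
  by rewrite !mulmxA -(mulmxA _ O) oO mulmx1 -(mulmxA U) mulmxV // mulmx1.
have BA : O^T *m invmx D *m U^T *m (U *m D *m O) = O^T *m O.
  by rewrite !mulmxA -(mulmxA _ U^T U) oU mulmx1 -(mulmxA O^T) mulVmx // mulmx1.
rewrite AB BA; split; rewrite ?trmx_mul ?trmxK //.
  by rewrite !mulmxA -(mulmxA _ U^T U) oU mulmx1.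
by rewrite !mulmxA -(mulmxA _ O) oO mulmx1.
Qed.

End SingularValues.

(** * Tucker products and matricization *)

(** Distributivity of products over sums, for dependent index families. *)
Lemma prod_sum_dffun (R : comNzRingType) (I : finType) (T_ : I -> finType)
    (F : forall i, T_ i -> R) :
  \prod_i \sum_(j : T_ i) F i j =
  \sum_(f : {dffun forall i, T_ i}) \prod_i F i (f i).
Proof.
rewrite (reindex (@dffun_of_fprod I T_)); last exact/onW_bij/dffun_of_fprod_bij.
pose P i := [ffun j => F i j].
transitivity (\sum_(t : fprod T_) \prod_(i in I) P i (t i)); last first.
  by apply: eq_bigr => t _; apply: eq_bigr => i _; rewrite !ffunE.
rewrite big_fprod.
apply: etrans (bigA_distr_big_dep (fun i => tagged_with T_ i)
  (fun i j => untag 0 (P i) j)).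
apply: eq_bigr => i _; rewrite -(big_tag (fun i => P i)).
by apply: eq_bigr => j _; rewrite ffunE.
Qed.

Section Matricization.
Context {R : realType} {m : nat}.
Implicit Types d p r : 'I_m -> nat.

Lemma big_mode_join d (j : 'I_m) (F : tidx d -> R) :
  \sum_k F k =
  \sum_(a < d j) \sum_(b < #|cidx d j|) F (mode_join a (enum_val b)).
Proof.
rewrite pair_bigA /=.
pose h (ab : 'I_(d j) * 'I_#|cidx d j|) := mode_join ab.1 (enum_val ab.2).
pose c (k : tidx d) : cidx d j := [ffun l : {l : 'I_m | l != j} => k (val l)].
pose g (k : tidx d) : 'I_(d j) * 'I_#|cidx d j| := (k j, enum_rank (c k)).
rewrite (reindex h) //; exists g => [[a b] _|k _]; rewrite /h /g /=.
  rewrite mode_join_eq; congr pair; rewrite -[RHS]enum_valK; congr enum_rank.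
  by apply/ffunP => l; rewrite /c ffunE mode_join_neq.
rewrite enum_rankK; apply/ffunP => l.
have [->|lj] := eqVneq l j; first by rewrite mode_join_eq.
by rewrite (mode_join_neq _ _ (exist _ l lj)) ffunE.
Qed.

Lemma prod_mode_split (j : 'I_m) (F : 'I_m -> R) :
  \prod_l F l = F j * \prod_(l : {l | l != j}) F (val l).
Proof. by rewrite (bigD1 j) //=; congr (_ * _); exact: big_sub. Qed.

Lemma tdot_matricize d (j : 'I_m) (M N : tensor R d) :
  tdot M N = mdot (matricize j M) (matricize j N).
Proof.
rewrite /tdot (big_mode_join j); apply: eq_bigr => a _; apply: eq_bigr => b _.
by rewrite !mxE.
Qed.

Lemma tnorm_matricize d (j : 'I_m) (M : tensor R d) :
  tnorm M = mnorm (matricize j M).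
Proof. by rewrite /tnorm (tdot_matricize j). Qed.

Lemma matricizeD d (j : 'I_m) (M N : tensor R d) :
  matricize j (M + N) = matricize j M + matricize j N.
Proof. by apply/matrixP => a b; rewrite !mxE ffunE. Qed.

Lemma matricizeN d (j : 'I_m) (M : tensor R d) :
  matricize j (- M) = - matricize j M.
Proof. by apply/matrixP => a b; rewrite !mxE ffunE. Qed.

Lemma matricizeB d (j : 'I_m) (M N : tensor R d) :
  matricize j (M - N) = matricize j M - matricize j N.
Proof. by rewrite matricizeD matricizeN. Qed.

Lemma matricize_sum d (j : 'I_m) (I : finType) (F : I -> tensor R d) :
  matricize j (\sum_i F i) = \sum_i matricize j (F i).
Proof.
apply: (big_morph (matricize j)) => [M N|]; first exact: matricizeD.
by apply/matrixP => a b; rewrite !mxE ffunE.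
Qed.

Lemma matricize_inj d (j : 'I_m) : injective (@matricize R m d j).
Proof.
move=> M N /matrixP e; apply/ffunP => k.
pose c : cidx d j := [ffun l : {l : 'I_m | l != j} => k (val l)].
have -> : k = mode_join (k j) c.
  apply/ffunP => l; have [->|lj] := eqVneq l j; first by rewrite mode_join_eq.
  by rewrite (mode_join_neq _ _ (exist _ l lj)) ffunE.
by have := e (k j) (enum_rank c); rewrite !mxE enum_rankK.
Qed.

(** The scalar multiple of a tensor. *)
Definition tscale d (a : R) (M : tensor R d) : tensor R d := [ffun i => a * M i].

Lemma matricizeZ d (j : 'I_m) a (M : tensor R d) :
  matricize j (tscale a M) = a *: matricize j M.
Proof. by apply/matrixP => b c; rewrite !mxE ffunE. Qed.

Lemma tucker_tucker d p r (M : tensor R d) (V : forall j, 'M[R]_(p j, d j))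
    (W : forall j, 'M[R]_(r j, p j)) :
  tucker (tucker M V) W = tucker M (fun j => W j *m V j).
Proof.
apply/ffunP => i; rewrite !ffunE.
under eq_bigr => k _ do rewrite ffunE big_distrl /=.
rewrite exchange_big /=; apply: eq_bigr => k _.
under eq_bigr => l _ do rewrite -mulrA.
rewrite -big_distrr /=; congr (_ * _).
under [RHS]eq_bigr => j _ do rewrite mxE.
rewrite (prod_sum_dffun (fun j a => W j (i j) a * V j a (k j))).
by apply: eq_bigr => l _; rewrite mulrC -big_split.
Qed.

Lemma eq_tucker d p (M : tensor R d) (V W : forall j, 'M[R]_(p j, d j)) :
  (forall j, V j = W j) -> tucker M V = tucker M W.
Proof.
move=> e; apply/ffunP => i; rewrite !ffunE; apply: eq_bigr => k _.
by congr (_ * _); apply: eq_bigr => j _; rewrite e.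
Qed.

Lemma tucker1 d (M : tensor R d) : tucker M (fun j => 1%:M) = M.
Proof.
apply/ffunP => i; rewrite !ffunE (bigD1 i) //= [X in _ + X]big1 => [|k ki].
  by rewrite addr0 big1 ?mulr1 // => j _; rewrite mxE eqxx.
have [j ij] : exists j, k j != i j.
  apply/existsP; apply: contraNT ki; rewrite negb_exists => /forallP h.
  by apply/eqP/ffunP => j; apply/eqP; have := h j; rewrite negbK.
by rewrite (bigD1 j) //= mxE eq_sym (negPf ij) mul0r mulr0.
Qed.

Lemma tdot_tucker d p (M : tensor R d) (N : tensor R p)
    (V : forall j, 'M[R]_(p j, d j)) :
  tdot (tucker M V) N = tdot M (tucker N (fun j => (V j)^T)).
Proof.
rewrite /tdot; under eq_bigr => i _ do rewrite ffunE big_distrl /=.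
rewrite exchange_big; apply: eq_bigr => k _; rewrite ffunE big_distrr /=.
apply: eq_bigr => i _; rewrite -mulrA; congr (_ * _).
rewrite mulrC; congr (_ * _); apply: eq_bigr => j _.
by rewrite /= mxE.
Qed.

Lemma matricize_tucker d p (j : 'I_m) (M : tensor R d)
    (V : forall j, 'M[R]_(p j, d j)) :
  matricize j (tucker M V) = V j *m matricize j M *m (kron_others j V)^T.
Proof.
apply/matrixP => a b; rewrite !mxE ffunE (big_mode_join j).
under [RHS]eq_bigr => k _ do rewrite !mxE big_distrl /=.
rewrite exchange_big /=; apply: eq_bigr => c _; apply: eq_bigr => e _.
rewrite (prod_mode_split j) !mode_join_eq !mxE mulrCA mulrA; congr (_ * _).
by apply: eq_bigr => l _; rewrite !mode_join_neq.
Qed.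

Lemma tuckerD d p (M N : tensor R d) (V : forall j, 'M[R]_(p j, d j)) :
  tucker (M + N) V = tucker M V + tucker N V.
Proof.
apply/ffunP => i; rewrite !ffunE -big_split; apply: eq_bigr => k _ /=.
by rewrite ffunE mulrDl.
Qed.

Lemma eq_kron_others d p (j : 'I_m) (V W : forall j, 'M[R]_(p j, d j)) :
  (forall l, l != j -> V l = W l) -> kron_others j V = kron_others j W.
Proof.
move=> e; apply/matrixP => a b; rewrite !mxE; apply: eq_bigr => -[l lj] _ /=.
by rewrite e.
Qed.

Lemma kron_othersM d p r (j : 'I_m) (V : forall j, 'M[R]_(d j, p j))
    (W : forall j, 'M[R]_(p j, r j)) :
  kron_others j V *m kron_others j W = kron_others j (fun l => V l *m W l).
Proof.
apply/matrixP => a b; rewrite !mxE.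
under [RHS]eq_bigr => l _ do rewrite mxE.
rewrite (prod_sum_dffun (fun (l : {l | l != j}) c =>
  V (val l) ((enum_val a : cidx d j) l) c * W (val l) c ((enum_val b : cidx r j) l))).
rewrite (reindex (@enum_rank (cidx p j))) /=; last first.
  by apply/onW_bij; exact: enum_rank_bij.
by apply: eq_bigr => c _; rewrite !mxE enum_rankK -big_split.
Qed.

Lemma kron_others_tr d p (j : 'I_m) (V : forall j, 'M[R]_(d j, p j)) :
  (kron_others j V)^T = kron_others j (fun l => (V l)^T).
Proof. by apply/matrixP => a b; rewrite !mxE; apply: eq_bigr => l _; rewrite mxE. Qed.

Lemma kron_others1 d (j : 'I_m) :
  kron_others j (fun l => 1%:M : 'M[R]_(d l)) = 1%:M.
Proof.
apply/matrixP => a b; rewrite !mxE.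
have [->|ab] := eqVneq a b; first by rewrite big1 // => l _; rewrite mxE eqxx.
have [l hl] : exists l, (enum_val a : cidx d j) l != (enum_val b : cidx d j) l.
  apply/existsP; apply: contraNT ab; rewrite negb_exists => /forallP h.
  by apply/eqP/enum_val_inj/ffunP => l; apply/eqP; have := h l; rewrite negbK.
by rewrite (bigD1 l) //= mxE (negPf hl) mul0r.
Qed.

Lemma kron_others_cols d r (j : 'I_m) (U : forall j, 'M[R]_(d j, r j)) :
  (forall j, orthonormal_cols (U j)) -> orthonormal_cols (kron_others j U).
Proof.
move=> oU; rewrite /orthonormal_cols kron_others_tr kron_othersM.
by rewrite -kron_others1; apply: eq_kron_others => l _; exact: oU.
Qed.

Lemma kron_others_orthoproj d (j : 'I_m) (P : forall j, 'M[R]_(d j)) :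
  (forall j, orthoproj (P j)) -> orthoproj (kron_others j P).
Proof.
move=> oP; rewrite /orthoproj kron_others_tr kron_othersM.
by split; apply: eq_kron_others => l _; case: (oP l).
Qed.

(** * Norms of tensors and duality *)

Lemma tdotC d (M N : tensor R d) : tdot M N = tdot N M.
Proof. by apply: eq_bigr => i _; rewrite mulrC. Qed.

Lemma tdotDl d (M N P : tensor R d) : tdot (M + N) P = tdot M P + tdot N P.
Proof. by rewrite /tdot -big_split; apply: eq_bigr => i _; rewrite ffunE mulrDl. Qed.

Lemma tdotZl d a (M N : tensor R d) : tdot (tscale a M) N = a * tdot M N.
Proof.
by rewrite /tdot big_distrr; apply: eq_bigr => i _ /=; rewrite ffunE mulrA.
Qed.

Lemma tdotNl d (M N : tensor R d) : tdot (- M) N = - tdot M N.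
Proof. by rewrite /tdot -sumrN; apply: eq_bigr => i _; rewrite ffunE mulNr. Qed.

Lemma tdotDr d (M N P : tensor R d) : tdot P (M + N) = tdot P M + tdot P N.
Proof. by rewrite tdotC tdotDl !(tdotC P). Qed.

Lemma tdotNr d (M N : tensor R d) : tdot M (- N) = - tdot M N.
Proof. by rewrite tdotC tdotNl tdotC. Qed.

Lemma tdot_ge0 d (M : tensor R d) : 0 <= tdot M M.
Proof. by apply: sumr_ge0 => i _; rewrite -expr2 sqr_ge0. Qed.

Lemma tnorm_ge0 d (M : tensor R d) : 0 <= tnorm M.
Proof. exact: sqrtr_ge0. Qed.
Hint Resolve tnorm_ge0 : core.

Lemma sqr_tnorm d (M : tensor R d) : tnorm M ^+ 2 = tdot M M.
Proof. by rewrite sqr_sqrtr // tdot_ge0. Qed.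

Lemma tdot_le d (M N : tensor R d) : tdot M N <= tnorm M * tnorm N.
Proof.
exact: (ip_cauchy_schwarz (@tdotC d) (@tdotDl d) (@tdotZl d) (@tdot_ge0 d)).
Qed.

Lemma tnormD d (M N : tensor R d) : tnorm (M + N) <= tnorm M + tnorm N.
Proof. exact: (ip_triangle (@tdotC d) (@tdotDl d) (@tdotZl d) (@tdot_ge0 d)). Qed.

Lemma tnormZ d a (M : tensor R d) : tnorm (tscale a M) = `|a| * tnorm M.
Proof. exact: (ip_scale (@tdotC d) (@tdotZl d)). Qed.

Lemma tnormN d (M : tensor R d) : tnorm (- M) = tnorm M.
Proof. by rewrite /tnorm tdotNl tdotNr opprK. Qed.

Lemma tnorm_sum d (I : finType) (F : I -> tensor R d) :
  tnorm (\sum_i F i) <= \sum_i tnorm (F i).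
Proof.
elim/big_rec2: _ => [|i a M _ h].
  by rewrite /tnorm /tdot big1 ?sqrtr0 // => i _; rewrite ffunE mul0r.
by rewrite (le_trans (tnormD _ _)) // lerD2l.
Qed.

Lemma tnorm_tucker_orthoproj d (M : tensor R d) (P : forall j, 'M[R]_(d j)) :
  (forall j, orthoproj (P j)) -> tnorm (tucker M P) <= tnorm M.
Proof.
move=> oP; have e : tdot (tucker M P) (tucker M P) = tdot M (tucker M P).
  rewrite tdot_tucker tucker_tucker; congr tdot.
  by apply: eq_tucker => j; have [-> ->] := oP j.
have := tdot_le M (tucker M P); rewrite -e -sqr_tnorm.
have [->|nz] := eqVneq (tnorm (tucker M P)) 0; first by [].
by rewrite expr2 ler_pM2r // lt_def nz tnorm_ge0.
Qed.

Lemma tnorm_tucker_cols d r (M : tensor R r) (U : forall j, 'M[R]_(d j, r j)) :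
  (forall j, orthonormal_cols (U j)) -> tnorm (tucker M U) = tnorm M.
Proof.
move=> oU; rewrite /tnorm tdot_tucker tucker_tucker; congr (Num.sqrt (tdot _ _)).
by rewrite -[RHS]tucker1; apply: eq_tucker => j; exact: oU.
Qed.

Lemma tnorm_tucker_colsT d r (M : tensor R d) (U : forall j, 'M[R]_(d j, r j)) :
  (forall j, orthonormal_cols (U j)) ->
  tnorm (tucker M (fun j => (U j)^T)) <= tnorm M.
Proof.
move=> oU; rewrite -(tnorm_tucker_cols (tucker M (fun j => (U j)^T)) oU).
rewrite tucker_tucker; apply: tnorm_tucker_orthoproj => j.
exact: orthoproj_cols.
Qed.

Lemma tucker_fixed d (M : tensor R d) (P : forall j, 'M[R]_(d j)) :
  (forall j, P j *m matricize j M = matricize j M) -> tucker M P = M.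
Proof.
move=> fix_M.
pose pre k (j : 'I_m) := if (j < k)%N then P j else 1%:M.
suff h k : (k <= m)%N -> tucker M (pre k) = M.
  by rewrite -[RHS](h m) //; apply: eq_tucker => j; rewrite /pre ltn_ord.
elim: k => [_|k IH km].
  by rewrite -[RHS]tucker1; apply: eq_tucker.
rewrite -[RHS](IH (ltnW km)); apply: (@matricize_inj d (Ordinal km)).
rewrite !matricize_tucker {1 3}/pre /= ltnSn ltnn mul1mx fix_M.
congr (_ *m _^T); apply: eq_kron_others => j; rewrite -val_eqE /= /pre => jk.
by rewrite ltnS leq_eqVlt (negPf jk).
Qed.

(** Duality for the norm [tnorm2r]: it controls the pairing with every tensor
    of Tucker rank at most [2 r]. *)
Lemma tdot_tnorm2r d r (G A : tensor R d) :
  (forall j, (\rank (matricize j A) <= 2 * r j)%N) ->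
  tdot G A <= tnorm2r r G * tnorm A.
Proof.
move=> rA; pose k j := minn (2 * r j) (d j).
have span j : exists U : 'M[R]_(d j, k j),
    orthonormal_cols U /\ U *m U^T *m matricize j A = matricize j A.
  by apply: orthonormal_span; rewrite ?geq_minr // leq_min rA rank_leq_row.
pose U j := projT1 (cid (span j)).
have oU j : orthonormal_cols (U j) by case: (projT2 (cid (span j))).
have UA j : U j *m (U j)^T *m matricize j A = matricize j A.
  by case: (projT2 (cid (span j))).
have AE : A = tucker (tucker A (fun j => (U j)^T)) U.
  by rewrite tucker_tucker tucker_fixed.
have -> : tdot G A = tdot (tucker G (fun j => (U j)^T)) (tucker A (fun j => (U j)^T)).
  rewrite {1}AE tdot_tucker; congr tdot.
  by apply: eq_tucker => j; rewrite trmxK.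
apply: le_trans (tdot_le _ _) _.
apply: ler_pM => //; last exact: tnorm_tucker_colsT.
apply: ub_le_sup; last by exists U.
by exists (tnorm G) => _ [W [oW ->]]; exact: tnorm_tucker_colsT.
Qed.

(** The family equal to [P] on the modes below [k] and to the identity on the
    others; it interpolates between the identity and [P]. *)
Definition modes_below d (P : forall j, 'M[R]_(d j)) (k : nat) (j : 'I_m) : 'M[R]_(d j) :=
  if (j < k)%N then P j else 1%:M.

Lemma modes_below_orthoproj d (P : forall j, 'M[R]_(d j)) k :
  (forall j, orthoproj (P j)) -> forall j, orthoproj (modes_below P k j).
Proof. by move=> oP j; rewrite /modes_below; case: ifP => _; [|exact: orthoproj1]. Qed.

Lemma modes_below_id d (P : forall j, 'M[R]_(d j)) (i : 'I_m) :
  modes_below P i i = 1%:M.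
Proof. by rewrite /modes_below ltnn. Qed.

Lemma tucker_telescope d (M : tensor R d) (P : forall j, 'M[R]_(d j)) :
  M - tucker M P =
  \sum_(i < m) (tucker M (modes_below P i) - tucker M (modes_below P i.+1)).
Proof.
pose F k := - tucker M (modes_below P k).
have := telescope_sumr F (leq0n m); rewrite big_mkord /F.
have -> : tucker M (modes_below P m) = tucker M P.
  by apply: eq_tucker => j; rewrite /modes_below ltn_ord.
have -> : tucker M (modes_below P 0) = M.
  by rewrite -[RHS]tucker1; apply: eq_tucker.
rewrite opprK addrC => <-.
by apply: eq_bigr => i _; rewrite opprK addrC.
Qed.

Lemma matricize_modes_below d (M : tensor R d) (P : forall j, 'M[R]_(d j)) (i : 'I_m) :
  matricize i (tucker M (modes_below P i)) =
  matricize i M *m (kron_others i (modes_below P i))^T.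
Proof. by rewrite matricize_tucker modes_below_id mul1mx. Qed.

Lemma matricize_telescope d (M : tensor R d) (P : forall j, 'M[R]_(d j)) (i : 'I_m) :
  matricize i (tucker M (modes_below P i) - tucker M (modes_below P i.+1)) =
  (1%:M - P i) *m matricize i M *m (kron_others i (modes_below P i))^T.
Proof.
rewrite matricizeB matricize_modes_below matricize_tucker.
have -> : modes_below P i.+1 i = P i by rewrite /modes_below ltnSn.
rewrite (@eq_kron_others _ _ _ (modes_below P i.+1) (modes_below P i)) => [|j].
  by rewrite !mulmxBl mul1mx.
by rewrite -val_eqE /= /modes_below ltnS leq_eqVlt => /negPf ->.
Qed.

End Matricization.
#[export] Hint Resolve tnorm_ge0 : core.

(** * The tangent space projection *)

Section Tangent.
Context {R : realType} {m : nat}.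
Variables (d r : 'I_m -> nat) (C : tensor R r) (U : forall j, 'M[R]_(d j, r j)).
Hypothesis oU : forall j, orthonormal_cols (U j).

Let X := tucker C U.
Let Pi j := U j *m (U j)^T.
Let PT := tangent_proj C U.

(** The projector on the row space of the [i]-th matricization of
    [tucker C U]. *)
Definition row_space_proj (i : 'I_m) : 'M[R]_(#|cidx d i|) :=
  kron_others i U *m (mp_inv (matricize i C) *m matricize i C)
    *m (kron_others i U)^T.

Let RP := row_space_proj.

(** The component of the tangent projection along which the [i]-th factor
    varies. *)
Definition tangent_piece (G : tensor R d) (i : 'I_m) : tensor R d :=
  tucker C (dfwith U (dotU C U G i)).

Let oPi j : orthoproj (Pi j). Proof. exact: orthoproj_cols. Qed.

Lemma row_space_orthoproj i : orthoproj (RP i).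
Proof.
apply: orthoproj_conj; first exact: kron_others_cols.
have [h1 h2 h3 h4] := mp_invP (matricize i C).
by split=> //; rewrite mulmxA h2.
Qed.

Lemma matricize_tangent_piece G i :
  matricize i (tangent_piece G i) = (1%:M - Pi i) *m matricize i G *m RP i.
Proof.
rewrite matricize_tucker dfwith_in (@eq_kron_others _ _ _ _ _ _ U) => [|l li].
  by rewrite /dotU /RP /row_space_proj !mulmxA.
by rewrite dfwith_out // eq_sym.
Qed.

Lemma matricize_core i : matricize i X = U i *m matricize i C *m (kron_others i U)^T.
Proof. exact: matricize_tucker. Qed.

Lemma Pi_fixes i : Pi i *m matricize i X = matricize i X.
Proof. by rewrite matricize_core /Pi !mulmxA -(mulmxA (U i)) oU mulmx1. Qed.

Lemma row_space_fixes i : matricize i X *m RP i = matricize i X.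
Proof.
rewrite matricize_core /RP /row_space_proj !mulmxA.
rewrite -(mulmxA _ _ (kron_others i U)) kron_others_cols // mulmx1.
by have [h _ _ _] := mp_invP (matricize i C); rewrite -!(mulmxA (U i)) h.
Qed.

Lemma row_space_factor i : exists S, RP i = S *m matricize i X.
Proof.
exists (kron_others i U *m mp_inv (matricize i C) *m (U i)^T).
rewrite matricize_core /RP /row_space_proj !mulmxA.
by rewrite -(mulmxA _ _ (U i)) oU mulmx1.
Qed.

Lemma rank_row_space i : (\rank (RP i) <= r i)%N.
Proof.
rewrite /RP /row_space_proj -mulmxA; apply: leq_trans (mxrankM_maxr _ _) _.
apply: leq_trans (mxrankM_maxl _ _) _; apply: leq_trans (mxrankM_maxr _ _) _.
exact: rank_leq_row.
Qed.

Lemma tucker_tangent_piece G i : tucker (tangent_piece G i) Pi = 0.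
Proof.
apply: (@matricize_inj _ _ _ i); rewrite matricize_tucker matricize_tangent_piece.
rewrite !mulmxA mulmxBr mulmx1 (oPi i).2 subrr !mul0mx.
by apply/matrixP => a b; rewrite !mxE ffunE.
Qed.

Lemma matricize_tangent_piece_other G i l : l != i ->
  exists B, matricize l (tangent_piece G i) = U l *m B.
Proof.
move=> li; rewrite matricize_tucker dfwith_out 1?eq_sym //.
by rewrite -mulmxA; eexists.
Qed.

(** Apart from the contribution of the [i]-th piece, the tangent projection has
    its mode-[i] columns in the span of [U i]. *)
Lemma matricize_tangent_proj G i : exists B,
  matricize i (PT G) = U i *m B + (1%:M - Pi i) *m matricize i G *m RP i.
Proof.
rewrite /PT /tangent_proj matricizeD matricize_sum (bigD1 i) //=.
rewrite -/(tangent_piece G i) matricize_tangent_piece.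
have [B ->] : exists B, \sum_(l < m | l != i)
    matricize i (tucker C (dfwith U (dotU C U G l))) = U i *m B.
  elim/big_rec: _ => [|l M li [B ->]]; first by exists 0; rewrite mulmx0.
  have [B' e] := @matricize_tangent_piece_other G l i ltac:(by rewrite eq_sym).
  by exists (B' + B); rewrite mulmxDr -e.
rewrite matricize_tucker addrCA -!mulmxA -mulmxDr addrC; eexists.
congr (_ + _); by rewrite !mulmxA.
Qed.

Lemma perp_tangent_proj G i :
  (1%:M - Pi i) *m matricize i (PT G) = (1%:M - Pi i) *m matricize i G *m RP i.
Proof.
have [B ->] := matricize_tangent_proj G i.
have z : (1%:M - Pi i) *m U i = 0.
  by rewrite mulmxBl mul1mx /Pi -mulmxA oU mulmx1 subrr.
by rewrite mulmxDr (mulmxA _ (U i)) z mul0mx add0r !mulmxA (orthoprojC (oPi i)).2.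
Qed.

Lemma tangent_piece_eq G H i :
  (1%:M - Pi i) *m matricize i G *m RP i = (1%:M - Pi i) *m matricize i H *m RP i ->
  tangent_piece G i = tangent_piece H i.
Proof. by move=> e; apply: (@matricize_inj _ _ _ i); rewrite !matricize_tangent_piece. Qed.

Lemma tangent_proj_idem G : PT (PT G) = PT G.
Proof.
rewrite {1}/PT {1}/tangent_proj [in RHS]/PT /tangent_proj; congr (_ + _).
  have tucker_sumP : tucker (\sum_i tangent_piece G i) Pi = 0.
    elim/big_rec: _ => [|i M _ IH]; last by rewrite tuckerD IH addr0 tucker_tangent_piece.
    by apply/ffunP => k; rewrite !ffunE big1 // => l _; rewrite ffunE mul0r.
  rewrite tuckerD tucker_sumP addr0 tucker_tucker; apply: eq_tucker => j.
  exact: (oPi j).2.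
apply: eq_bigr => i _; apply: tangent_piece_eq.
by rewrite perp_tangent_proj -mulmxA (row_space_orthoproj i).2.
Qed.

Lemma tangent_proj_sym G H : tdot (PT G) H = tdot G (PT H).
Proof.
rewrite /PT /tangent_proj tdotDl tdotDr; congr (_ + _).
  by rewrite tdot_tucker; congr tdot; apply: eq_tucker => j; exact: (oPi j).1.
have tsuml (I : finType) (F : I -> tensor R d) (N : tensor R d) :
    tdot (\sum_i F i) N = \sum_i tdot (F i) N.
  apply: (big_morph (fun M => tdot M N)) => [A B|]; first exact: tdotDl.
  by rewrite /tdot big1 // => k _; rewrite ffunE mul0r.
rewrite (tdotC G) !tsuml; apply: eq_bigr => i _; rewrite (tdotC _ G).
rewrite -!/(tangent_piece _ _) !(tdot_matricize i) !matricize_tangent_piece.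
rewrite mdot_mulr (row_space_orthoproj i).1 mdot_mull (orthoprojC (oPi i)).1.
by rewrite mulmxA.
Qed.

Lemma tangent_proj_id : PT X = X.
Proof.
rewrite /PT /tangent_proj big1 => [|i _].
  by rewrite addr0 tucker_fixed // => j; exact: Pi_fixes.
apply: (@matricize_inj _ _ _ i); rewrite -/(tangent_piece X i).
rewrite matricize_tangent_piece mulmxBl mul1mx Pi_fixes subrr mul0mx.
by apply/matrixP => a b; rewrite !mxE ffunE.
Qed.

Lemma tangent_projD G H : PT (G + H) = PT G + PT H.
Proof.
rewrite /PT /tangent_proj tuckerD addrACA -big_split /=; congr (_ + _).
apply: eq_bigr => i _; rewrite -!/(tangent_piece _ _).
apply: (@matricize_inj _ _ _ i); rewrite matricizeD !matricize_tangent_piece.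
by rewrite matricizeD mulmxDr mulmxDl.
Qed.

Lemma tangent_projN G : PT (- G) = - PT G.
Proof.
apply/eqP; rewrite -addr_eq0 -tangent_projD addNr; apply/eqP.
have := tangent_projD 0 0; rewrite addr0 => /eqP.
by rewrite -subr_eq0 opprD addrA subrr add0r oppr_eq0 => /eqP.
Qed.

(** Tangent vectors and residuals have Tucker rank at most [2 r], which is what
    makes them accessible to [tdot_tnorm2r]. *)
Lemma rank_tangent_proj G j : (\rank (matricize j (PT G)) <= 2 * r j)%N.
Proof.
have [B ->] := matricize_tangent_proj G j.
rewrite mul2n -addnn; apply: leq_trans (mxrank_add _ _) _.
apply: leq_add; first exact: leq_trans (mxrankM_maxl _ _) (rank_leq_col _).
exact: leq_trans (mxrankM_maxr _ _) (rank_row_space j).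
Qed.

Lemma rank_tangent_residual (M : tensor R d) j : (\rank (matricize j M) <= r j)%N ->
  (\rank (matricize j (M - PT M)%R) <= 2 * r j)%N.
Proof.
move=> rM; have [B e] := matricize_tangent_proj M j.
have -> : matricize j (M - PT M) =
    matricize j M *m (1%:M - RP j) + U j *m ((U j)^T *m matricize j M *m RP j - B).
  rewrite matricizeB e mulmxBr mulmx1 mulmxBr !mulmxA -/(Pi j).
  rewrite !mulmxBl mul1mx opprD opprB -!addrA; congr (_ + _).
  by rewrite addrC -addrA addrCA.
rewrite mul2n -addnn; apply: leq_trans (mxrank_add _ _) _.
apply: leq_add; first exact: leq_trans (mxrankM_maxl _ _) rM.
exact: leq_trans (mxrankM_maxl _ _) (rank_leq_col _).
Qed.

(** A generalised inverse of [A] of operator norm at most [1 / lam]. *)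
Definition bounded_ginv (lam : R) n p (A : 'M[R]_(n, p)) : Prop :=
  exists B : 'M[R]_(p, n), A *m B *m A = A /\
    forall q (Y : 'M[R]_(n, q)), lam * mnorm (B *m Y) <= mnorm Y.

(** The curvature of the low-rank set: [M] lies in the tangent space at [X] up
    to a term of second order in [X - M].  The residual is a sum over the modes;
    the mode-[i] matricization of the [i]-th term is [(1 - Pi i) M (Q - RP i)]
    with [Q] a projector.  Writing [M = M B M], it is the product of
    [(1 - Pi i) M] and [M (Q - RP i)], both of the size of [X - M] because [X]
    is annihilated by [1 - Pi i] and [Q - RP i], with [B] in between. *)
Lemma tangent_residual (M : tensor R d) (lam : R) : 0 < lam ->
  (forall i, bounded_ginv lam (matricize i M)) ->
  lam * tnorm (M - PT M) <= 2 * m%:R * tnorm (X - M) ^+ 2.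
Proof.
move=> lam0 ginvM; set E := X - M.
pose step (i : 'I_m) := tucker M (modes_below Pi i) - tucker M (modes_below Pi i.+1).
have -> : M - PT M = \sum_(i < m) (step i - tangent_piece M i).
  by rewrite sumrB -tucker_telescope /PT /tangent_proj opprD addrA.
suff piece (i : 'I_m) : lam * tnorm (step i - tangent_piece M i) <= 2 * tnorm E ^+ 2.
  apply: (@le_trans _ _ (\sum_(i < m) lam * tnorm (step i - tangent_piece M i))).
    by rewrite -mulr_sumr; apply: ler_wpM2l (tnorm_sum _); exact: ltW.
  rewrite (le_trans (ler_sum _ (fun i _ => piece i))) //.
  by rewrite sumr_const card_ord -[leLHS]mulr_natr mulrAC.
set Q := (kron_others i (modes_below Pi i))^T.
have oQ : orthoproj Q.
  have := kron_others_orthoproj i (modes_below_orthoproj i oPi).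
  by rewrite /Q => h; rewrite h.1.
have XQ : matricize i X *m Q = matricize i X.
  rewrite -matricize_modes_below tucker_fixed // => j.
  by rewrite /modes_below; case: ifP => _; rewrite ?Pi_fixes ?mul1mx.
have XR := row_space_fixes i.
have EE : matricize i E = matricize i X - matricize i M by rewrite matricizeB.
have [B [MBM nB]] := ginvM i.
(* [M = X - E], and both projectors fix the rows of [X]. *)
pose Z := matricize i M *m (Q - RP i).
rewrite (tnorm_matricize i) matricizeB matricize_telescope matricize_tangent_piece.
have -> : (1%:M - Pi i) *m matricize i M *m Q - (1%:M - Pi i) *m matricize i M *m RP i
    = (1%:M - Pi i) *m matricize i M *m (B *m Z).
  by rewrite /Z -mulmxBr -!mulmxA; congr (_ *m _); rewrite !mulmxA MBM.
have nZ : mnorm Z <= 2 * tnorm E.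
  have -> : Z = matricize i E *m RP i - matricize i E *m Q.
    by rewrite EE /Z !mulmxBl XQ XR mulmxBr opprB [RHS]addrC addrA subrK.
  rewrite (le_trans (mnormB _ _)) // mulr_natl mulr2n (tnorm_matricize i).
  by rewrite lerD // mnorm_projr //; exact: row_space_orthoproj.
have nPM : mnorm ((1%:M - Pi i) *m matricize i M) <= tnorm E.
  have -> : (1%:M - Pi i) *m matricize i M = - ((1%:M - Pi i) *m matricize i E).
    have z : (1%:M - Pi i) *m matricize i X = 0.
      by rewrite mulmxBl mul1mx Pi_fixes subrr.
    by rewrite EE mulmxBr z sub0r opprK.
  by rewrite mnormN (tnorm_matricize i) mnorm_projl //; exact: orthoprojC.
have h1 := mnormM ((1%:M - Pi i) *m matricize i M) (B *m Z).
have h2 := nB _ Z.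
apply: (@le_trans _ _ (mnorm ((1%:M - Pi i) *m matricize i M) * (lam * mnorm (B *m Z)))).
  by rewrite mulrCA ler_wpM2l // ltW.
apply: (@le_trans _ _ (tnorm E * (2 * tnorm E))); last by rewrite mulrCA -expr2.
apply: ler_pM nPM (le_trans h2 nZ); first exact: mnorm_ge0.
by apply: mulr_ge0; [exact: ltW | exact: mnorm_ge0].
Qed.

(** Truncating a tangent step costs only a second order term.  In the mode-[i]
    matricization, let [Z] be such that [Z X = (1 - Pi i) zeta] for the tangent
    step [zeta]: then [(1 + Z) (X + Pi i zeta)] has rank at most [r i] and
    differs from [X + zeta] by [Z (Pi i zeta)] only, so that Eckart-Young bounds
    what the truncation in this mode removes. *)
Lemma hosvd_tangent_step (M : tensor R d) (lam a : R) G N N' :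
  0 < lam -> (forall i, tucker_rank M i = r i) ->
  (forall i, bounded_ginv lam (matricize i M)) ->
  tnorm (X - M) < lam -> N = X + tscale a (PT G) -> is_hosvd r N N' ->
  (lam - tnorm (X - M)) * tnorm (N - N') <=
    m%:R * tnorm (tscale a (PT G)) ^+ 2.
Proof.
move=> lam0 rM ginvM near_M NE [V [topV ->]].
set zeta := tscale a (PT G) in NE *; set eps := tnorm (X - M) in near_M *.
have c0 : 0 < lam - eps by rewrite subr_gt0.
have rd i : (r i <= d i)%N by rewrite -rM rank_leq_row.
have perp_zeta i : (1%:M - Pi i) *m matricize i zeta *m RP i
                 = (1%:M - Pi i) *m matricize i zeta.
  rewrite matricizeZ -!scalemxAr -!scalemxAl perp_tangent_proj.
  by rewrite -mulmxA (row_space_orthoproj i).2.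
have approx i : exists B, (\rank B <= r i)%N /\
    (lam - eps) * mnorm (matricize i N - B) <= tnorm zeta ^+ 2.
  have [B0 [MBM nB]] := ginvM i.
  have Xeps : mnorm (matricize i X - matricize i M) <= eps.
    by rewrite /eps (tnorm_matricize i) matricizeB.
  have [Y [XY nY]] := right_inverse_perturb lam0 near_M (rM i) MBM nB (oU i)
    (Pi_fixes i) Xeps.
  have RYX : RP i *m Y *m matricize i X = RP i.
    have [S ->] := row_space_factor i.
    by rewrite -(mulmxA S _ Y) XY -mulmxA Pi_fixes.
  pose Z := (1%:M - Pi i) *m matricize i zeta *m RP i *m Y.
  exists ((1%:M + Z) *m (matricize i X + Pi i *m matricize i zeta)); split.
    rewrite -Pi_fixes -mulmxDr /Pi -(mulmxA (U i)) (mulmxA _ (U i)).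
    by apply: leq_trans (mxrankM_maxl _ _) (rank_leq_col _).
  have -> : matricize i N - (1%:M + Z) *m (matricize i X + Pi i *m matricize i zeta)
      = - ((1%:M - Pi i) *m matricize i zeta *m RP i *m (Y *m (Pi i *m matricize i zeta))).
    have ZX : Z *m matricize i X = matricize i zeta - Pi i *m matricize i zeta.
      by rewrite /Z -(mulmxA _ Y) -(mulmxA _ (RP i)) (mulmxA (RP i)) RYX perp_zeta mulmxBl mul1mx.
    rewrite [in RHS](mulmxA _ Y) -/Z NE matricizeD mulmxDl mul1mx mulmxDr ZX.
    set x := matricize i X; set z := matricize i zeta; set y := Pi i *m z.
    have -> : x + y + (z - y + Z *m y) = x + z + Z *m y.
      by rewrite addrA addrACA subrr addr0.
    by rewrite opprD addrA subrr add0r.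
  rewrite mnormN.
  have h1 := mnormM ((1%:M - Pi i) *m matricize i zeta *m RP i)
    (Y *m (Pi i *m matricize i zeta)).
  have h2 := nY _ (Pi i *m matricize i zeta).
  have h3 : mnorm (Pi i *m matricize i zeta) <= tnorm zeta.
    by rewrite (tnorm_matricize i) mnorm_projl.
  have h4 : mnorm ((1%:M - Pi i) *m matricize i zeta *m RP i) <= tnorm zeta.
    by rewrite perp_zeta (tnorm_matricize i) mnorm_projl //; exact: orthoprojC.
  apply: le_trans (ler_wpM2l (ltW c0) h1) _; rewrite mulrCA expr2.
  apply: ler_pM h4 (le_trans h2 h3); first exact: mnorm_ge0.
  by apply: mulr_ge0; [exact: ltW | exact: mnorm_ge0].
have VP j : orthoproj (V j *m (V j)^T).
  apply: orthoproj_cols.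
  by have [] := @eckart_young _ _ _ _ _ 0 _ (rd j) (topV j); rewrite ?mxrank0.
rewrite tucker_telescope.
apply: le_trans (ler_wpM2l (ltW c0) (tnorm_sum _)) _.
rewrite mulr_sumr; pose bound (_ : 'I_m) := tnorm zeta ^+ 2.
apply: (@le_trans _ _ (\sum_(i < m) bound i)); last first.
  by rewrite sumr_const card_ord mulr_natl.
apply: ler_sum => i _; have [B [rB hB]] := approx i.
apply: le_trans hB; rewrite ler_pM2l // (tnorm_matricize i) matricize_telescope.
have oQ := kron_others_orthoproj i (modes_below_orthoproj i VP).
rewrite oQ.1 (le_trans (mnorm_projr _ oQ)) // mulmxBl mul1mx.
by have [] := eckart_young (rd i) (topV i) rB.
Qed.

End Tangent.

(** * Real arithmetic of one step *)

Section StepArithmetic.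
Context {R : realType}.

(** The descent inequality: [n] is the distance to the target after the tangent
    step, [D] before it, [t] the normalised step size, [q] the squared ratio of
    the sharpness to the subgradient bound, [s] the first order decrease. *)
Lemma descent_arith (a q t D Db n s : R) :
  0 < a -> a <= 1 / 2 -> 0 < q -> q <= 1 -> a / 4 <= t -> t <= 3 / 4 * a ->
  0 <= D -> D <= Db -> 0 <= n ->
  31 / 32 * (t * q * Db * D) <= s ->
  n ^+ 2 <= D ^+ 2 - 2 * s + t ^+ 2 * q * Db ^+ 2 ->
  n <= Db * (1 - 3 / 16 * (a * q)).
Proof.
move=> a0 a1 q0 q1 t1 t2 D0 DDb n0 hs hn.
have t0 : 0 <= t by lra.
have Db0 : 0 <= Db by lra.
pose k := 31 / 16 * (t * q).
have tq : t * q <= t by rewrite ler_piMr.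
have tq0 : 0 <= t * q by rewrite mulr_ge0 // ltW.
have k1 : k <= 1 by rewrite /k; lra.
(* The quadratic [D (D - k Db)] is largest at the end point [D = Db]. *)
have h1 : D ^+ 2 - k * Db * D <= Db ^+ 2 * (1 - k).
  have : (D - Db) * (D + Db - k * Db) <= 0.
    apply: mulr_le0_ge0; first by lra.
    by have : k * Db <= Db; [rewrite ler_piMl | lra].
  lra.
have h2 : n ^+ 2 <= Db ^+ 2 * (1 - k + t ^+ 2 * q) by rewrite /k in h1 *; lra.
have h3 : 3 / 8 * (a * q) <= k - t ^+ 2 * q.
  have -> : k - t ^+ 2 * q = (31 / 16 * t - t ^+ 2) * q by rewrite /k; ring.
  by rewrite mulrA ler_wpM2r ?(ltW q0) //; nra.
have aq0 : 0 <= a * q by rewrite mulr_ge0 // ltW.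
have aq1 : a * q <= 1 / 2 by rewrite (le_trans _ a1) // ler_piMr // ltW.
have rhs0 : 0 <= Db * (1 - 3 / 16 * (a * q)) by apply: mulr_ge0 => //; lra.
rewrite -[n]ger0_norm // -[leRHS]ger0_norm // -!sqrtr_sqr ler_wsqrtr //.
apply: le_trans h2 _; rewrite exprMn ler_wpM2l ?sqr_ge0 //.
by have := sqr_ge0 (a * q); lra.
Qed.

(** The estimates of one step combined: [k] is the order of the tensors, [D] the
    distance to the target before the step, [s] the pairing of the tangent
    gradient with the error, [p] the norm of the tangent gradient, [w] the
    norm of the normal part of the target, [n] the distance after the tangent step, and [y]
    the displacement by the truncation.  The tangent step gains
    [3 / 16 * (a * q)] and the truncation loses at most [1 / 8 * (a * q)], in
    units of [Db]. *)
Lemma step_arith (k lam D Db mu L eta w p n y s : R) :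
  1 <= k -> 0 < lam -> 0 < D -> D <= Db -> 0 < mu -> mu <= L ->
  Db <= 1 / 16 * lam * (1 / (k + 1) * (mu ^+ 2 / L ^+ 2)) ->
  Db <= 1 / 16 * lam * (1 / (k * (k + 3)) * (mu / L)) ->
  1 / 4 * (k + 1)^-1 * Db * (mu / L ^+ 2) <= eta
    <= 3 / 4 * (k + 1)^-1 * Db * (mu / L ^+ 2) ->
  0 <= w -> lam * w <= 2 * k * D ^+ 2 -> mu * D - L * w <= s ->
  0 <= p -> p <= L -> 0 <= n -> n ^+ 2 = D ^+ 2 - 2 * eta * s + eta ^+ 2 * p ^+ 2 ->
  0 <= y -> (lam - D) * y <= k * (eta * p) ^+ 2 ->
  n + y <= (1 - 1 / (16 * (k + 1)) * (mu ^+ 2 / L ^+ 2)) * Db.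
Proof.
move=> k1 lam0 D0 DDb mu0 muL; set a := (k + 1)^-1; set q := mu ^+ 2 / L ^+ 2.
move=> hDb1 hDb2 /andP[heta1 heta2] w0 hw hs p0 pL n0 hn y0 hy.
have k0 : 0 < k by lra.
have L0 : 0 < L by exact: lt_le_trans muL.
have l2 : 0 < lam / 2 by rewrite divr_gt0.
have Db0 : 0 < Db by exact: lt_le_trans DDb.
have a0 : 0 < a by rewrite invr_gt0; lra.
have ka : k * a <= 1 by rewrite /a ler_pdivrMr; lra.
have a1 : a <= 1 / 2.
  by rewrite /a -[leRHS]invrK lef_pV2 ?posrE ?invr_gt0; lra.
have q0 : 0 < q by rewrite divr_gt0 ?exprn_gt0.
have muL1 : mu / L <= 1 by rewrite ler_pdivrMr // mul1r.
have muL0 : 0 < mu / L by rewrite divr_gt0.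
have q1 : q <= 1 by rewrite /q -expr_div_n expr_le1 // ltW.
have aq0 : 0 < a * q by rewrite mulr_gt0.
have aq1 : a * q <= 1 / 2 by rewrite (le_trans _ a1) // ler_piMr // ltW.
have -> : 1 / (16 * (k + 1)) * q = 1 / 16 * (a * q).
  by rewrite /a; field; rewrite lt0r_neq0 //; lra.
have hDb : Db <= 1 / 16 * lam * (a * q) by rewrite -[a]mul1r.
pose t := eta * L ^+ 2 / (Db * mu).
have u0 : 0 < mu / L ^+ 2 by rewrite divr_gt0 ?exprn_gt0.
have etaE : eta = t * (Db * (mu / L ^+ 2)).
  by rewrite /t; field; rewrite !lt0r_neq0.
have v0 : 0 < Db * (mu / L ^+ 2) by rewrite mulr_gt0.
have t1 : a / 4 <= t.
  rewrite -(ler_pM2r v0) -etaE; apply: le_trans heta1.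
  by rewrite le_eqVlt; apply/orP; left; apply/eqP; ring.
have t2 : t <= 3 / 4 * a.
  rewrite -(ler_pM2r v0) -etaE; apply: le_trans heta2 _.
  by rewrite le_eqVlt; apply/orP; left; apply/eqP; ring.
have t0 : 0 < t by apply: lt_le_trans t1; rewrite divr_gt0.
have e0 : 0 < eta by rewrite etaE mulr_gt0.
have etamu : eta * mu = t * q * Db.
  by rewrite etaE /q; field; rewrite lt0r_neq0.
have etaL : eta ^+ 2 * L ^+ 2 = t ^+ 2 * q * Db ^+ 2.
  by rewrite etaE /q; field; rewrite lt0r_neq0.
have Lw : L * w <= 1 / 32 * (mu * D).
  (* [1 / 16 * 2 k / (k (k + 3)) <= 1 / 32] since [k + 3 >= 4] *)
  have h : k * Db * L <= 1 / 64 * lam * mu.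
    have kk : 0 < k * (k + 3) by rewrite mulr_gt0 ?addr_gt0.
    have -> : 1 / 64 * lam * mu = k * (1 / 16 * lam * (1 / (k * 4) * (mu / L))) * L.
      by field; rewrite !lt0r_neq0 //; lra.
    rewrite ler_wpM2r ?(ltW L0) // ler_wpM2l; [|lra|].
    - by [].
    - apply: le_trans hDb2 _; rewrite ler_wpM2l //; first by lra.
      rewrite ler_wpM2r ?(ltW muL0) // ler_pM2l // lef_pV2 ?posrE //.
        by rewrite ler_wpM2l //; lra.
      by lra.
  rewrite -(ler_pM2l lam0) mulrCA.
  apply: (@le_trans _ _ (L * (2 * k * D ^+ 2))); first by rewrite ler_wpM2l // ltW.
  have -> : L * (2 * k * D ^+ 2) = 2 * D * (k * D * L) by ring.
  have -> : lam * (1 / 32 * (mu * D)) = 2 * D * (1 / 64 * lam * mu) by field.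
  rewrite ler_wpM2l //; first by lra.
  apply: le_trans h; rewrite ler_wpM2r ?(ltW L0) // ler_wpM2l //; lra.
have hn1 : n <= Db * (1 - 3 / 16 * (a * q)).
  apply: (@descent_arith a q t D Db n (eta * s)) => //; first exact: ltW.
    have -> : 31 / 32 * (t * q * Db * D) = eta * (31 / 32 * (mu * D)).
      by rewrite -etamu; ring.
    by rewrite ler_wpM2l ?(ltW e0) //; lra.
  rewrite hn -etaL mulrA lerD2l ler_wpM2l ?sqr_ge0 //.
  by rewrite lerXn2r ?nnegrE // ltW.
have hy1 : y <= Db * (1 / 8 * (a * q)).
  have Dblam : Db <= lam / 32.
    have : lam * (a * q) <= lam * (1 / 2) by rewrite ler_pM2l.
    lra.
  have half : lam / 2 <= lam - D by lra.
  have h1 : lam / 2 * y <= k * (eta * p) ^+ 2.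
    by apply: le_trans hy; rewrite ler_wpM2r.
  have h2 : (eta * p) ^+ 2 <= t ^+ 2 * q * Db ^+ 2.
    by rewrite exprMn -etaL ler_wpM2l ?sqr_ge0 // lerXn2r ?nnegrE // ltW.
  have h3 : k * t ^+ 2 <= 9 / 16 * a.
    have h : t ^+ 2 <= (3 / 4 * a) ^+ 2.
      by rewrite lerXn2r ?nnegrE ?(ltW t0) //; lra.
    apply: (@le_trans _ _ (k * (3 / 4 * a) ^+ 2)); first by rewrite ler_wpM2l // ltW.
    have -> : k * (3 / 4 * a) ^+ 2 = 9 / 16 * a * (k * a) by field.
    by rewrite ler_piMr //; lra.
  have h4 : k * (eta * p) ^+ 2 <= 9 / 16 * (a * q) * Db ^+ 2.
    apply: (@le_trans _ _ (k * (t ^+ 2 * q * Db ^+ 2))).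
      by rewrite ler_wpM2l // ltW.
    have -> : k * (t ^+ 2 * q * Db ^+ 2) = (k * t ^+ 2) * (q * Db ^+ 2) by ring.
    have -> : 9 / 16 * (a * q) * Db ^+ 2 = (9 / 16 * a) * (q * Db ^+ 2) by ring.
    by rewrite ler_wpM2r // mulr_ge0 ?sqr_ge0 // ltW.
  have h5 : 9 / 16 * (a * q) * Db ^+ 2 <= lam / 2 * (Db * (1 / 8 * (a * q))).
    have -> : 9 / 16 * (a * q) * Db ^+ 2 = (9 / 16 * Db) * (Db * (a * q)) by ring.
    have -> : lam / 2 * (Db * (1 / 8 * (a * q))) = lam / 16 * (Db * (a * q)) by field.
    apply: ler_wpM2r; first by rewrite mulr_ge0 ?(ltW Db0) ?(ltW aq0).
    by lra.
  rewrite -(ler_pM2l l2); exact: le_trans h1 (le_trans h4 h5).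
lra.
Qed.

End StepArithmetic.

(** * Convergence of the iteration *)

Lemma rate_itv (R : realType) (m : nat) (mu L : R) :
  0 < mu -> mu <= L -> 0 <= rate m mu L <= 1.
Proof.
move=> mu0 muL; have L0 : 0 < L by exact: lt_le_trans muL.
have q1 : mu ^+ 2 / L ^+ 2 <= 1.
  by rewrite ler_pdivrMr ?exprn_gt0 // mul1r lerXn2r ?nnegrE ?(ltW mu0) ?(ltW L0).
have q0 : 0 <= mu ^+ 2 / L ^+ 2 by rewrite divr_ge0 ?sqr_ge0.
have b0 : 0 <= 1 / (16 * m.+1%:R) :> R by rewrite divr_ge0 // mulr_ge0.
have b1 : 1 / (16 * m.+1%:R) <= 1 :> R.
  have : (1 : R) <= m.+1%:R by rewrite ler1n.
  by move=> m1; rewrite ler_pdivrMr; lra.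
by rewrite /rate subr_ge0 gerBl mulr_ile1 // mulr_ge0.
Qed.

Section Convergence.
Context {R : realType} {m : nat}.
Variables (d r : 'I_m -> nat) (Mstar : tensor R d).
Hypothesis m_gt0 : (0 < m)%N.
Hypothesis rank_Mstar : forall j, tucker_rank Mstar j = r j.

Lemma signal_strength_le j : signal_strength r Mstar <= singval (r j) (matricize j Mstar).
Proof.
apply: ge_inf; last by exists j.
by exists 0 => _ [i _ <-]; exact: singval_ge0.
Qed.

Lemma signal_strength_ginv j : 0 < signal_strength r Mstar ->
  bounded_ginv (signal_strength r Mstar) (matricize j Mstar).
Proof.
move=> lam0; apply: ginv_singval => //.
by have := signal_strength_le j; rewrite -(rank_Mstar j).
Qed.

Lemma low_rank_tucker (C : tensor R r) (U : forall j, 'M[R]_(d j, r j)) :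
  low_rank r (tucker C U).
Proof.
move=> j; rewrite /tucker_rank matricize_tucker -mulmxA.
exact: leq_trans (mxrankM_maxl _ _) (rank_leq_col _).
Qed.

Lemma low_rank_hosvd (N N' : tensor R d) : is_hosvd r N N' -> low_rank r N'.
Proof.
move=> [V [_ ->]] j; rewrite /tucker_rank matricize_tucker -!mulmxA.
exact: leq_trans (mxrankM_maxl _ _) (rank_leq_col _).
Qed.

Lemma sqr_tnorm_step (A B : tensor R d) c :
  tnorm (A + tscale c B) ^+ 2 =
  tnorm A ^+ 2 + 2 * c * tdot B A + c ^+ 2 * tnorm B ^+ 2.
Proof.
rewrite !sqr_tnorm tdotDl !tdotDr !tdotZl (tdotC A) (tdotC B (tscale _ _)) !tdotZl.
ring.
Qed.

(** One step of the iteration from [X], at distance [D <= Db] of the target,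
    under sharpness [mu] and subgradient bound [L] holding at [X].  Sharpness
    and the subgradient inequality together force [mu <= L]. *)
Lemma rsgrad_step_contract (f : tensor R d -> R) (X X' : tensor R d)
    (mu L Db eta : R) (lam := signal_strength r Mstar) (D := tnorm (X - Mstar)) :
  0 < lam -> 0 < D -> D <= Db -> 0 < mu ->
  mu * D <= f X - f Mstar ->
  (forall G, subdiff f X G -> tnorm2r r G <= L) ->
  Db <= 1 / 16 * lam * (1 / (m%:R + 1) * (mu ^+ 2 / L ^+ 2)) ->
  Db <= 1 / 16 * lam * (1 / (m%:R * (m%:R + 3)) * (mu / L)) ->
  1 / 4 * (m%:R + 1)^-1 * Db * (mu / L ^+ 2) <= eta
    <= 3 / 4 * (m%:R + 1)^-1 * Db * (mu / L ^+ 2) ->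
  rsgrad_step r f eta X X' ->
  [/\ mu <= L, low_rank r X' & tnorm (X' - Mstar) <= rate m mu L * Db].
Proof.
move=> lam0 D0 DDb mu0 sharp subL hDb1 hDb2 heta [G [C [U [subG oU XE hosvd]]]].
have gL := subL G subG; set PT := tangent_proj C U.
set E := X - Mstar.
have ginv i := signal_strength_ginv i lam0.
(* Pairings with tensors of Tucker rank at most [2 r] are controlled by [L]. *)
have dual A : (forall j, (\rank (matricize j A) <= 2 * r j)%N) ->
    tdot G A <= L * tnorm A.
  move=> /(@tdot_tnorm2r _ _ _ _ G) h; apply: le_trans h _.
  exact: ler_wpM2r (tnorm_ge0 _) _ _ gL.
have GE : f X - f Mstar <= tdot G E.
  have := subG Mstar; rewrite -opprB tdotNr -/E; lra.
have muL : mu <= L.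
  rewrite -(ler_pM2r D0); apply: le_trans sharp (le_trans GE _).
  apply: dual => j; rewrite matricizeB mul2n -addnn.
  apply: leq_trans (mxrank_add _ _) _; rewrite mxrank_opp.
  apply: leq_add; first by rewrite XE; exact: low_rank_tucker.
  by have := rank_Mstar j; rewrite /tucker_rank => ->.
have PTX : PT X = X by rewrite /PT XE tangent_proj_id.
have PTB A B : PT (A - B) = PT A - PT B by rewrite /PT tangent_projD // tangent_projN.
have residE : E - PT E = - (Mstar - PT Mstar).
  by rewrite /E PTB PTX !opprB addrC addrA subrK.
have resid : lam * tnorm (Mstar - PT Mstar) <= 2 * m%:R * D ^+ 2.
  by rewrite /D XE; exact: tangent_residual.
set w := tnorm (Mstar - PT Mstar) in resid.
have slope : mu * D - L * w <= tdot (PT G) E.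
  have h : tdot G (E - PT E) <= L * w.
    rewrite /w -tnormN -residE; apply: dual => j.
    rewrite residE matricizeN mxrank_opp; apply: rank_tangent_residual => //.
    by have := rank_Mstar j; rewrite /tucker_rank => ->.
  rewrite /PT tangent_proj_sym // -/PT; rewrite tdotDr tdotNr in h; lra.
have PTG : tnorm (PT G) <= L.
  have h : tnorm (PT G) ^+ 2 <= L * tnorm (PT G).
    rewrite sqr_tnorm {1}/PT tangent_proj_sym // tangent_proj_idem //.
    by apply: dual => j; exact: rank_tangent_proj.
  have [->|nz] := eqVneq (tnorm (PT G)) 0; first by rewrite (le_trans (ltW mu0)).
  by move: h; rewrite expr2 ler_pM2r // lt_def nz tnorm_ge0.
pose N := X + tscale (- eta) (PT G).
have hosvdN : is_hosvd r N X'.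
  suff -> : N = [ffun i => X i - eta * tangent_proj C U G i] by [].
  by apply/ffunP => i; rewrite !ffunE mulNr.
have nN : tnorm (N - Mstar) ^+ 2 =
    D ^+ 2 - 2 * eta * tdot (PT G) E + eta ^+ 2 * tnorm (PT G) ^+ 2.
  have -> : N - Mstar = E + tscale (- eta) (PT G) by rewrite /N /E addrAC.
  by rewrite sqr_tnorm_step sqrrN mulrN mulNr.
have DE : D < lam.
  have L0 : 0 < L by exact: lt_le_trans muL.
  have q1 : mu ^+ 2 / L ^+ 2 <= 1.
    by rewrite ler_pdivrMr ?exprn_gt0 // mul1r lerXn2r ?nnegrE ?(ltW mu0) ?(ltW L0).
  have m1 : (1 : R) <= m%:R by rewrite ler1n.
  have a1 : 1 / (m%:R + 1 : R) <= 1 by rewrite ler_pdivrMr; lra.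
  have aq : 1 / (m%:R + 1) * (mu ^+ 2 / L ^+ 2) <= 1.
    rewrite mulr_ile1 // ?divr_ge0 ?sqr_ge0 //; lra.
  have h : 1 / 16 * lam * (1 / (m%:R + 1) * (mu ^+ 2 / L ^+ 2)) <= 1 / 16 * lam * 1.
    by rewrite ler_wpM2l //; lra.
  lra.
have trunc : (lam - D) * tnorm (N - X') <= m%:R * (eta * tnorm (PT G)) ^+ 2.
  have -> : (eta * tnorm (PT G)) ^+ 2 = tnorm (tscale (- eta) (PT G)) ^+ 2.
    by rewrite tnormZ normrN !exprMn real_normK ?num_real.
  by rewrite /D {1}XE; apply: (hosvd_tangent_step oU lam0 rank_Mstar ginv) hosvdN;
    rewrite -XE.
split=> //; first exact: low_rank_hosvd hosvdN.
have -> : X' - Mstar = (N - Mstar) - (N - X').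
  by rewrite opprB [RHS]addrC addrA subrK.
apply: le_trans (tnormD _ _) _; rewrite tnormN /rate -[m.+1%:R]natr1.
apply: (@step_arith _ m%:R lam D Db mu L eta w (tnorm (PT G))
  (tnorm (N - Mstar)) (tnorm (N - X')) (tdot (PT G) E)); rewrite ?ler1n //.
exact: tnorm_ge0.
Qed.

End Convergence.

Theorem proposition2 (R : realType) :
  exists2 c0 : R, 0 < c0 &
  forall (m : nat) (d r : 'I_m -> nat) (n : nat)
    (Mstar : tensor R d) (rho : R -> R)
    (X : 'I_n -> tensor R d) (Y : 'I_n -> R)
    (tau_comp tau_stat mu_comp mu_stat L_comp L_stat : R),
  (0 < m)%N ->
  (forall j, tucker_rank Mstar j = r j) ->
  (forall x, 0 <= rho x) ->
  0 < tau_stat -> tau_stat < tau_comp ->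
  0 < mu_comp -> 0 < mu_stat -> 0 < L_comp -> 0 < L_stat ->
  let f := loss rho X Y in
  let lambda := signal_strength r Mstar in
  dual_phase_regular r f Mstar tau_comp tau_stat mu_comp mu_stat L_comp L_stat ->
  forall (M : nat -> tensor R d) (eta : nat -> R) (eta0 : R),
  let D := fun l => tnorm (M l - Mstar) in
  low_rank r (M 0%N) ->
  D 0%N <= c0 * lambda *
    Num.min (1 / (m.+1)%:R * (mu_stat ^+ 2 / L_stat ^+ 2))
   (Num.min (1 / (m.+1)%:R * (mu_comp ^+ 2 / L_comp ^+ 2))
   (Num.min (1 / (m * (m + 3))%:R * (mu_stat / L_stat))
            (1 / (m * (m + 3))%:R * (mu_comp / L_comp)))) ->
  1 / 4 * (m.+1)%:R^-1 * D 0%N * (mu_comp / L_comp ^+ 2) <= eta0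
    <= 3 / 4 * (m.+1)%:R^-1 * D 0%N * (mu_comp / L_comp ^+ 2) ->
  let iteration := fun k =>
    rsgrad_step r f (eta k) (M k) (M k.+1) /\
    stepsize_rule m tau_comp tau_stat mu_comp mu_stat L_comp L_stat eta0
      k (D k) (eta k) in
  forall l : nat,
  (forall k, (k < l)%N -> tau_stat <= D k) ->
  (forall k, (k < l)%N -> iteration k) ->
  (tau_comp <= D l -> D l <= rate m mu_comp L_comp ^+ l * D 0%N) /\
  (tau_stat <= D l < tau_comp -> iteration l ->
     D l.+1 <= rate m mu_stat L_stat * D l).
Proof.
exists (1 / 16); first by rewrite divr_gt0.
move=> m d r n Mstar rho X Y tau_comp tau_stat mu_comp mu_stat L_comp L_stat.
move=> m_gt0 rank_Mstar _ tau_stat0 tau_lt muc0 mus0 Lc0 Ls0 f lambda.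
move=> [sharp1 sharp2 subg1 subg2] M eta eta0 D rank_M0.
set cond1 := 1 / m.+1%:R * (mu_stat ^+ 2 / L_stat ^+ 2).
set cond2 := 1 / m.+1%:R * (mu_comp ^+ 2 / L_comp ^+ 2).
set cond3 := 1 / (m * (m + 3))%:R * (mu_stat / L_stat).
set cond4 := 1 / (m * (m + 3))%:R * (mu_comp / L_comp).
move=> hD0 heta0 iteration.
have cond_gt0 : [/\ 0 < cond1, 0 < cond2, 0 < cond3 & 0 < cond4].
  have mm : 0 < (m * (m + 3))%:R :> R by rewrite ltr0n muln_gt0 m_gt0 addn_gt0 orbT.
  by split; apply: mulr_gt0; rewrite divr_gt0 ?exprn_gt0 // ?ltr0n.
have lam_gt0 : 0 < D 0%N -> 0 < lambda.
  move=> D00; have := lt_le_trans D00 hD0; case: cond_gt0 => p1 p2 p3 p4.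
  by rewrite pmulr_lgt0 ?lt_min ?p1 ?p2 ?p3 // pmulr_rgt0 // divr_gt0.
have D0_small : 0 < D 0%N -> [/\ D 0%N <= 1 / 16 * lambda * cond1,
    D 0%N <= 1 / 16 * lambda * cond2, D 0%N <= 1 / 16 * lambda * cond3 &
    D 0%N <= 1 / 16 * lambda * cond4].
  move=> /lam_gt0 l0; have cl : 0 < 1 / 16 * lambda by rewrite mulr_gt0 ?divr_gt0.
  move: hD0; rewrite -(ler_pdivrMl _ _ cl) !le_min => /and4P[h1 h2 h3 h4].
  by split; rewrite -(ler_pdivrMl _ _ cl).
have mS : m.+1%:R = m%:R + 1 :> R by rewrite natr1.
have mmS : (m * (m + 3))%:R = m%:R * (m%:R + 3) :> R by rewrite natrM natrD.
(* The two phases are instances of the same step estimate: in phase two the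
   sharpness and the subgradient bound are scaled by the current distance. *)
have step1 l Db : tau_comp <= D l -> D l <= Db -> Db <= D 0%N -> low_rank r (M l) ->
    1 / 4 * (m%:R + 1)^-1 * Db * (mu_comp / L_comp ^+ 2) <= eta l
      <= 3 / 4 * (m%:R + 1)^-1 * Db * (mu_comp / L_comp ^+ 2) ->
    rsgrad_step r f (eta l) (M l) (M l.+1) ->
    [/\ mu_comp <= L_comp, low_rank r (M l.+1) & D l.+1 <= rate m mu_comp L_comp * Db].
  move=> phase DDb DbD0 rM heta step.
  have Dl0 : 0 < D l by lra.
  have D00 : 0 < D 0%N by lra.
  have [_ s2 _ s4] := D0_small D00; rewrite /cond2 /cond4 mS mmS in s2 s4.
  have ph : phase1 r Mstar tau_comp (M l) by [].
  apply: (rsgrad_step_contract m_gt0 rank_Mstar (lam_gt0 D00) Dl0 DDb muc0 _ _ _ _ heta step).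
  - exact: sharp1.
  - by move=> G; exact: subg1.
  - exact: le_trans s2.
  - exact: le_trans s4.
have step2 l : tau_stat <= D l < tau_comp -> D l <= D 0%N -> low_rank r (M l) ->
    iteration l ->
    [/\ mu_stat <= L_stat, low_rank r (M l.+1) & D l.+1 <= rate m mu_stat L_stat * D l].
  move=> phase DD0 rM [step [_ /(_ phase) heta]].
  have [/andP[ge_stat _]] := phase; have Dl0 : 0 < D l by lra.
  have D00 : 0 < D 0%N by lra.
  have [s1 _ s3 _] := D0_small D00; rewrite /cond1 /cond3 mS mmS in s1 s3.
  have ph : phase2 r Mstar tau_comp tau_stat (M l) by [].
  have Dn0 : D l != 0 by rewrite gt_eqF.
  have Ln0 : L_stat != 0 by rewrite gt_eqF.
  have ratio : mu_stat * D l / (L_stat * D l) = mu_stat / L_stat by field; rewrite Ln0 Dn0.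
  have ratio2 : (mu_stat * D l) ^+ 2 / (L_stat * D l) ^+ 2 = mu_stat ^+ 2 / L_stat ^+ 2.
    by rewrite -!expr_div_n ratio.
  have heta' : 1 / 4 * (m%:R + 1)^-1 * D l * (mu_stat * D l / (L_stat * D l) ^+ 2) <= eta l
      <= 3 / 4 * (m%:R + 1)^-1 * D l * (mu_stat * D l / (L_stat * D l) ^+ 2).
    have e c : c * (m%:R + 1)^-1 * D l * (mu_stat * D l / (L_stat * D l) ^+ 2) =
        c * m.+1%:R^-1 * (mu_stat / L_stat ^+ 2).
      rewrite mS -!mulrA; congr (_ * (_ * _)); field.
      by rewrite Dn0 Ln0.
    by rewrite !e.
  have muD0 : 0 < mu_stat * D l by rewrite mulr_gt0.
  have [h1 h2 h3] : [/\ mu_stat * D l <= L_stat * D l, low_rank r (M l.+1) &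
      D l.+1 <= rate m (mu_stat * D l) (L_stat * D l) * D l].
    apply: (rsgrad_step_contract m_gt0 rank_Mstar (lam_gt0 D00) Dl0 (lexx _) muD0
      _ _ _ _ heta' step).
    - by rewrite -mulrA -expr2; exact: sharp2.
    - by move=> G; exact: subg2.
    - by rewrite ratio2; exact: le_trans s1.
    - by rewrite ratio; exact: le_trans s3.
  split=> //; first by rewrite -(ler_pM2r Dl0).
  by move: h3; rewrite /rate ratio2.
(* The bound on the distance is only claimed for iterates in phase one; it is
   vacuous once phase two has begun, since the distance then decreases. *)
have invariant l : (forall k, (k < l)%N -> tau_stat <= D k) ->
    (forall k, (k < l)%N -> iteration k) ->
    [/\ low_rank r (M l), D l <= D 0%N &
        tau_comp <= D l -> D l <= rate m mu_comp L_comp ^+ l * D 0%N /\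
                           rate m mu_comp L_comp ^+ l <= 1].
  elim: l => [_ _|l IH far iter]; first by split=> // _; rewrite expr0 mul1r.
  have [|k kl|rMl DD0 rate_l] := IH.
  - by move=> k kl; apply: far; exact: ltnW.
  - by apply: iter; exact: ltnW.
  have D00 : 0 < D 0%N by have := far l (ltnSn l); lra.
  have [phase|phase] := leP tau_comp (D l).
    have [step [/(_ phase) etaE _]] := iter l (ltnSn l).
    have [le_rate rate1] := rate_l phase.
    have DbD0 : rate m mu_comp L_comp ^+ l * D 0%N <= D 0%N.
      by rewrite ler_piMl // ltW.
    have rl0 : 0 <= rate m mu_comp L_comp ^+ l.
      by rewrite -(pmulr_lge0 _ D00); apply: le_trans le_rate; lra.
    have heta : 1 / 4 * (m%:R + 1)^-1 * (rate m mu_comp L_comp ^+ l * D 0%N)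
        * (mu_comp / L_comp ^+ 2) <= eta l <=
        3 / 4 * (m%:R + 1)^-1 * (rate m mu_comp L_comp ^+ l * D 0%N)
        * (mu_comp / L_comp ^+ 2).
      have e c : c * (m%:R + 1)^-1 * (rate m mu_comp L_comp ^+ l * D 0%N)
          * (mu_comp / L_comp ^+ 2) = rate m mu_comp L_comp ^+ l *
          (c * m.+1%:R^-1 * D 0%N * (mu_comp / L_comp ^+ 2)).
        by rewrite mS; ring.
      by case/andP: heta0 => e1 e2; rewrite !e etaE !ler_wpM2l.
    have [muL rM' hD] := step1 l _ phase le_rate DbD0 rMl heta step.
    have /andP[r0 r1] := rate_itv m muc0 muL.
    rewrite mulrA -exprS in hD.
    have rS1 : rate m mu_comp L_comp ^+ l.+1 <= 1 by rewrite exprn_ile1.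
    split=> //; apply: le_trans hD _; rewrite ler_piMl // ltW //.
  have [|muL rM' hD] := step2 l _ DD0 rMl (iter l (ltnSn l)).
    by rewrite far //=.
  have /andP[r0 r1] := rate_itv m mus0 muL.
  have decr : D l.+1 <= D l.
    by apply: le_trans hD _; rewrite ler_piMl // tnorm_ge0.
  split=> //; first exact: le_trans decr DD0.
  by move=> h; have := le_lt_trans decr phase; rewrite ltNge h.
move=> l far iter; have [rMl DD0 rate_l] := invariant l far iter.
split=> [phase|phase it]; first by have [] := rate_l phase.
by have [] := step2 l phase DD0 rMl it.
Qed.
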